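(* Let $X$ be a topological space. Suppose $N\subset\mathcal{M}_s(X)$ is convexly analytic and there is a countable set $H\subset \mathcal{C}(X,[-1,1])$ such that $|\nu|(X)=\sup\{\nu(h): h\in H\}$ for every $\nu\in N$. Let $\mu\in\mathcal{M}_s(X)$ be such that $\mu\perp\nu$ for every $\nu\in N$. Then there is a Baire set $B\subset X$ such that $\mu$ sits on $B$ and every $\nu\in N$ sits on $X\setminus B$.
   Context: $X$ is an arbitrary topological space. $\mathcal{C}(X,Y)$ is the set of continuous functions $X\to Y$; $\mathcal{C}(X)=\mathcal{C}(X,\mathbb{R})$; $\mathcal{C}_b(X)$ is the set of bounded functions in $\mathcal{C}(X)$. The Baire sets of $X$ are the members of the smallest $\sigma$-algebra with respect to which all functions in $\mathcal{C}(X)$ are measurable. $\mathcal{M}_s(X)$ is the set of signed (real-valued, countably additive) measures on the Baire sets of $X$. For $\mu\in\mathcal{M}_s(X)$, $\mu(h):=\int_X h\,d\mu$, and $|\mu|=\mu^++\mu^-$ is the total variation, where $\mu=\mu^+-\mu^-$ is the Jordan decomposition. $\mathcal{M}_s(X)$ is always equipped with the weak$^*$-topology, i.e. the coarsest topology making all maps $\mu\mapsto\mu(f)$, $f\in\mathcal{C}_b(X)$, continuous; with it $\mathcal{M}_s(X)$ is a locally convex space. A measure $\mu\in\mathcal{M}_s(X)$ sits on a Baire set $B$ if $\mu(E)=0$ for every Baire set $E\subset X\setminus B$. Measures $\mu,\nu$ are mutually singular, $\mu\perp\nu$, if they sit on disjoint Baire sets. A multi-valued map $\phi\colon S\to T$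 between topological spaces is usco if each value $\phi(s)$ is a compact subset of $T$ and for every open $G\subset T$ the set $\{s\in S:\phi(s)\subset G\}$ is open. For $U\subset S$, $\phi(U):=\bigcup_{u\in U}\phi(u)$. $\mathcal{N}$ is the space of sequences of positive integers with the product topology. A subset $U$ of a locally convex space $T$ is convexly analytic if there is an usco map $\phi\colon\mathcal{N}\to T$ such that $U=\phi(\mathcal{N})$ and the closed convex hull of $\phi(K)$ is contained in $U$ for every compact $K\subset\mathcal{N}$. *)

(* Defs.v *)
From HB Require Import structures.
From mathcomp Require Import all_boot all_order all_algebra.
From mathcomp Require Import all_classical all_reals all_analysis.
Import Order.TTheory GRing.Theory Num.Theory.
Import numFieldNormedType.Exports.

Set Implicit Arguments.
Unset Strict Implicit.
Unset Printing Implicit Defensive.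

Local Open Scope classical_set_scope.
Local Open Scope ring_scope.

Section baire_sets.
Context (R : realType) (X : topologicalType).

Definition baire_generator : set (set X) :=
  \bigcup_(f in [set f : X -> R | continuous f])
    preimage_set_system [set: X] f measurable.

Definition baire : set (set X) := <<s baire_generator >>.

End baire_sets.
Arguments baire_generator R {X}.
Arguments baire R {X}.

Section signed_measures.
Context (R : realType) (X : topologicalType).

(* A signed measure on the Baire sets is encoded as a function on all subsets
   of X that vanishes outside the Baire sets, so that Leibniz equality is
   equality of signed measures.  Countable additivity forces nu set0 = 0. *)
Definition is_signed_measure (nu : set X -> R) : Prop :=
  (forall F : nat -> set X, (forall n, baire R (F n)) -> trivIset [set: nat] F ->
     (fun n => \sum_(0 <= i < n) nu (F i)) @ \oo --> nu (\bigcup_n F n)) /\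
  (forall A, ~ baire R A -> nu A = 0).

Definition signed_measure_pred : {pred set X -> R} :=
  fun nu => `[< is_signed_measure nu >].

Lemma signed_measure_submod : submod_closed signed_measure_pred.
Proof.
split; first by apply/asboolP; split => // F _ _;
  under eq_fun do rewrite big1//; exact: cvg_cst.
move=> a u v /asboolP[u1 u2] /asboolP[v1 v2]; apply/asboolP; split.
- move=> F mF tF; rewrite [X in X @ _ --> _](_ : _ =
    (fun n => a * (\sum_(0 <= i < n) u (F i)) + \sum_(0 <= i < n) v (F i))).
    by apply: cvgD; [apply: cvgMl_tmp; exact: u1|exact: v1].
  by apply/funext => n; rewrite mulr_sumr -big_split.
- by move=> A nA; rewrite -[LHS]/(a * u A + v A) u2// v2// mulr0 addr0.
Qed.

HB.instance Definition _ := GRing.isSubmodClosed.Build R (set X -> R)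
  signed_measure_pred signed_measure_submod.

Record signed_measure := SignedMeasure {
  signed_measure_fun :> set X -> R ;
  _ : signed_measure_fun \in signed_measure_pred }.

HB.instance Definition _ := [isSub for signed_measure_fun].
HB.instance Definition _ := [Choice of signed_measure by <:].
HB.instance Definition _ := [SubChoice_isSubZmodule of signed_measure by <:].
HB.instance Definition _ := [SubZmodule_isSubLmodule of signed_measure by <:].

Lemma signed_measureP (nu : signed_measure) : is_signed_measure nu.
Proof. by case: nu => nu /= /asboolP. Qed.

(* Measurable types are pointed, whereas X may be empty, so the measurable
   space of Baire sets depends on a point of X *)
Definition pointed_at (x0 : X) : Type := X.

HB.instance Definition _ (x0 : X) := Choice.copy (pointed_at x0) X.
HB.instance Definition _ (x0 : X) := isPointed.Build (pointed_at x0) x0.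

Definition baire_space (x0 : X) :=
  g_sigma_algebraType (baire_generator R : set (set (pointed_at x0))).

Section at_point.
Variables (x0 : X) (nu : signed_measure).

Definition charge_at (A : set (baire_space x0)) : \bar R := (nu A)%:E.

Let charge_at0 : charge_at set0 = 0%E.
Proof.
have [sigma_nu _] := signed_measureP nu.
have mset0 (n : nat) : baire R (@set0 X) by exact: sigma_algebra0.
have := sigma_nu (fun=> set0) mset0 (@trivIset_set0 _ _ _).
rewrite bigcup0// => cv.
have /cvg_lim : (fun n => \sum_(0 <= i < n.+1) nu set0 -
    \sum_(0 <= i < n) nu set0) @ \oo --> (nu set0 - nu set0).
  apply: cvgB => //.
  by rewrite (cvg_shiftS (fun n => \sum_(0 <= i < n) nu set0)).
rewrite subrr (_ : (fun n => _) = (fun=> nu set0)).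
  by rewrite lim_cst// /charge_at => ->.
by apply/funext => n; rewrite big_nat_recr//= addrAC subrr add0r.
Qed.

Let charge_at_fin A : measurable A -> charge_at A \is a fin_num.
Proof. by []. Qed.

Let charge_at_sigma_additive : semi_sigma_additive charge_at.
Proof.
move=> F mF tF mUF; have [sigma_nu _] := signed_measureP nu.
rewrite (_ : (fun n => _) = EFin \o (fun n => \sum_(0 <= i < n) nu (F i))).
  by apply: cvg_EFin; [exact: nearW|exact: sigma_nu].
by apply/funext => n; rewrite /= sumEFin.
Qed.

HB.instance Definition _ := isCharge.Build _ (baire_space x0) R charge_at
  charge_at0 charge_at_fin charge_at_sigma_additive.

End at_point.

End signed_measures.

Arguments charge_at {R X} x0 nu A.

Section jordan_decomposition_at.
Context (R : realType) (X : topologicalType) (x0 : X).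
Variable nu : signed_measure R X.

Definition hahn_at :
    {PN : set (baire_space R x0) * set (baire_space R x0) |
      hahn_decomposition (charge_at x0 nu) PN.1 PN.2}.
Proof.
apply: cid; have [P [N PN]] := Hahn_decomposition (charge_at x0 nu).
by exists (P, N).
Qed.

Definition pos_part_at := jordan_pos (projT2 hahn_at).
Definition neg_part_at := jordan_neg (projT2 hahn_at).
Definition variation_at := charge_variation (projT2 hahn_at).

End jordan_decomposition_at.
Arguments pos_part_at {R X} x0 nu.
Arguments neg_part_at {R X} x0 nu.
Arguments variation_at {R X} x0 nu.

Definition some_point (X : Type) : option X :=
  if pselect ([set: X] !=set0) is left X0 then Some (projT1 (cid X0)) else None.

Section integral_and_variation.
Context (R : realType) (X : topologicalType).
Implicit Types (nu : signed_measure R X) (h : X -> R).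

(* If X is empty, the only signed measure is 0. *)
Definition smintegral nu h : R :=
  if some_point X is Some x0 then
    \int[pos_part_at x0 nu]_x h x - \int[neg_part_at x0 nu]_x h x
  else 0.

Definition smvariation nu (A : set X) : \bar R :=
  if some_point X is Some x0 then variation_at x0 nu A else 0%E.

Definition sits_on nu (B : set X) : Prop :=
  forall E, baire R E -> E `<=` ~` B -> nu E = 0.

Definition mutually_singular mu nu : Prop :=
  exists A B : set X, [/\ baire R A, baire R B, A `&` B = set0,
    sits_on mu A & sits_on nu B].

End integral_and_variation.

Section weak_star_topology.
Context (R : realType) (X : topologicalType).

Definition bounded_continuous : Type :=
  {f : X -> R | continuous f /\ bounded_fun f}.

Definition weak_star_topology : Type :=
  sup_topology (fun f : bounded_continuous => Topological.class
    (initial_topology (fun nu : signed_measure R X => smintegral nu (sval f)))).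

HB.instance Definition _ :=
  Topological.copy (signed_measure R X) weak_star_topology.

End weak_star_topology.

Definition usco (S T : topologicalType) (phi : S -> set T) : Prop :=
  (forall s, compact (phi s)) /\
  (forall G, open G -> open [set s | phi s `<=` G]).

(* The subspace topology of nat on the set of positive integers is discrete. *)
Definition baire_seq : topologicalType :=
  {ptws nat -> [set n : nat | (0 < n)%N]}.

Definition closed_convex_hull (R : realType) (T : preTopologicalLmodType R)
    (A : set T) : set T :=
  smallest [set C | closed C /\ @convex_set R T C] A.

(* Local convexity of T plays no role in the definition. *)
Definition convexly_analytic (R : realType) (T : preTopologicalLmodType R)
    (U : set T) : Prop :=
  exists phi : baire_seq -> set T, [/\ usco phi,
    U = \bigcup_s phi s &
    forall K, compact K -> closed_convex_hull (\bigcup_(s in K) phi s) `<=` U].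

(* Main.v *)
(* For h in H and e > 0 the measures nu in N with nu(h') <= nu(h) + e for all h'
   in H form the trace on N of a closed convex set, and these traces cover N for
   each fixed e.  On such a trace |nu|(X) <= nu(h) + e, so |nu|(g) is within e of
   the affine weak* continuous expression nu(h g) whenever 0 <= g <= 1.

   Compact pieces are separated from mu by a minimax argument: if no continuous
   f : X -> [0, 1] had both |mu|(f) small and nu(h (1 - f)) < e on a compact set K
   of such measures, finite convex combinations of points of K would converge to
   a positive functional on continuous functions on K, represented by a measure
   by Riesz' theorem; its barycentre is a signed measure in the closed convex
   hull of K, hence in N, which is not singular to mu.

   To pass to the whole trace, consider the capacity inf |mu|(F^2) over Baire
   functions F with values in [0, 1] such that |nu|(1 - F) <= 2 e on a given
   piece.  By convexity it is continuous along increasing unions, so Choquet's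
   scheme over initial segments of the space of sequences reduces the claim to
   compact pieces.  Level sets of such F yield |mu|-null sets carrying
   each nu of the trace up to 4 e, and their countable union carries all of N. *)
Require Import Defs.
From HB Require Import structures.
From mathcomp Require Import all_boot all_order all_algebra.
From mathcomp Require Import all_classical all_reals all_analysis.
From mathcomp Require Import finmap.
From mathcomp Require Import measurable_realfun ring lra.
Import Order.TTheory GRing.Theory Num.Theory.
Import numFieldNormedType.Exports.
Set Implicit Arguments.
Unset Strict Implicit.
Unset Printing Implicit Defensive.
Local Open Scope classical_set_scope.
Local Open Scope ring_scope.

(** * Finite minimax and compactness *)

(** The quantity [|nu|(1 - f)] is in general neither affine nor weak* continuous in [nu], so neither
    minimax nor upper semicontinuity applies to it directly. On a trace it is replaced by
    [nu(h (1 - f))], at the price of an error [e]. This explains the constants: [e] bounds the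
    linear expression, [2 e] includes the norming error, and [4 e] comes from cutting [F] at the
    level 1/2.

    A limit of convex combinations of measures is at first only a functional, and on an arbitrary
    [X] nothing makes such a limit countably additive. Countable additivity of the barycentre comes
    from dominated convergence under the representing measure on [K], whose points are measures of
    uniformly bounded variation. This is where convex analyticity enters: the barycentre lies in
    [N], and also in the closed convex set that cuts out the trace, so it inherits both singularity
    to [mu] and the norming inequality.

    Compact pieces give continuous [f], but increasing unions require suprema of sequences, whence
    Baire functions [F] in the capacity. *)

Lemma convex_alternative2 (R : realType) (D : set (R * R)) :
  (forall (y z : R * R) t, D y -> D z -> 0 <= t <= 1 ->
     D ((1 - t) * y.1 + t * z.1, (1 - t) * y.2 + t * z.2)) ->
  (forall y, D y -> y.1 <= 0 \/ y.2 <= 0) ->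
  exists2 t : R, 0 <= t <= 1 & forall y, D y -> (1 - t) * y.1 + t * y.2 <= 0.
Proof.
move=> Dconv Dneg.
(* For a point with [0 < y.1], hence [y.2 <= 0], the wanted inequality reads
   [y.1 / (y.1 - y.2) <= t]. [S] collects these lower bounds, together with 0, and its supremum is
   the least admissible [t]. *)
pose S := [set r : R | r = 0 \/
  exists2 y, D y & 0 < y.1 /\ r = y.1 / (y.1 - y.2)].
have Spos (y : R * R) : D y -> 0 < y.1 -> y.2 <= 0.
  by move=> Dy y1; case: (Dneg _ Dy) => //; rewrite leNgt y1.
have Sle1 r : S r -> 0 <= r <= 1.
  move=> [->|[y Dy [y1 ->]]]; first by rewrite lexx ler01.
  have y2 := Spos _ Dy y1.
  have h : 0 < y.1 - y.2 by lra.
  apply/andP; split; first by apply: divr_ge0; exact: ltW.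
  by rewrite ler_pdivrMr//; lra.
have S0 : S 0 by left.
have supS : has_sup S.
  by split; [exists 0|exists 1 => r /Sle1 /andP[]].
exists (sup S).
  apply/andP; split; first exact: (ub_le_sup supS.2 S0).
  by apply: ge_sup; [exists 0|move=> r /Sle1 /andP[]].
move=> y Dy.
have [y2|y2] := leP y.2 0.
  have [y1|y1] := leP y.1 0.
    have /andP[s0 s1] : 0 <= sup S <= 1.
      apply/andP; split; first exact: (ub_le_sup supS.2 S0).
      by apply: ge_sup; [exists 0|move=> r /Sle1 /andP[]].
    nra.
  have : y.1 / (y.1 - y.2) <= sup S.
    by apply: (ub_le_sup supS.2); right; exists y.
  rewrite ler_pdivrMr; last lra.
  nra.
have y1 : y.1 <= 0 by case: (Dneg _ Dy) => //; rewrite leNgt y2.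
have : sup S <= - y.1 / (y.2 - y.1).
  apply: ge_sup; first by exists 0.
  move=> r [->|[z Dz [z1 ->]]].
    by rewrite divr_ge0//; lra.
  have z2 := Spos _ Dz z1.
  rewrite ler_pdivrMr; last lra.
  rewrite mulrAC ler_pdivlMr; last lra.
  rewrite leNgt; apply/negP => h.
  have h' : y.1 * z.2 < z.1 * y.2 by nra.
  have p1 : 0 < z.1 - y.1 by lra.
  have p2 : 0 < y.2 - z.2 by lra.
  (* On the segment from [z] to [y] the second coordinate is positive beyond [u] and the first one
     before [v]. If the lower bound from [z] exceeded the upper bound from [y], then [u < v], and
     the point at [(u + v) / 2] would have both coordinates positive. *)
  pose u := - z.2 / (y.2 - z.2); pose v := z.1 / (z.1 - y.1).
  have u0 : 0 <= u by rewrite divr_ge0//; lra.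
  have v1 : v <= 1 by rewrite ler_pdivrMr//; lra.
  have eu : u * (y.2 - z.2) = - z.2 by rewrite /u divfK//; lra.
  have ev : v * (z.1 - y.1) = z.1 by rewrite /v divfK//; lra.
  have uv : u < v.
    by rewrite /u ltr_pdivrMr// mulrAC ltr_pdivlMr//; nra.
  have := Dneg _ (Dconv z y ((u + v) / 2) Dz Dy _).
  have -> : 0 <= (u + v) / 2 <= 1 by apply/andP; split; lra.
  move=> /(_ isT)/=.
  by case; nra.
rewrite ler_pdivlMr; last lra.
nra.
Qed.

(* Induction on the number of coordinates: on the part of [D] where the last
   coordinate is positive the others admit weights, and the two-dimensional
   case combines these with the last coordinate. *)
Lemma convex_alternative (R : realType) (n : nat) (D : set (nat -> R)) :
  (forall y z t, D y -> D z -> 0 <= t <= 1 ->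
     D (fun i => (1 - t) * y i + t * z i)) ->
  (forall y, D y -> exists2 i, (i < n.+1)%N & y i <= 0) ->
  exists w : nat -> R, [/\ forall i, 0 <= w i, \sum_(i < n.+1) w i = 1 &
    forall y, D y -> \sum_(i < n.+1) w i * y i <= 0].
Proof.
elim: n D => [|n IH] D Dconv Dneg.
  exists (fun=> 1); split => // [|y /Dneg[[]// _ y0]].
    by rewrite big_ord_recl big_ord0 addr0.
  by rewrite big_ord_recl big_ord0 addr0 mul1r.
have [||w [w0 w1 wD]] := IH [set y | D y /\ 0 < y n.+1].
- move=> y z t [Dy y0] [Dz z0] t01; split; first exact: Dconv.
  case/andP: t01 => t0 t1.
  have [->|tn0] := eqVneq t 0; first by rewrite subr0 mul0r addr0 mul1r.
  have {}t0 : 0 < t by rewrite lt_def tn0.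
  by rewrite ltr_wpDl ?mulr_gt0// mulr_ge0 ?subr_ge0// ltW.
- move=> y [Dy y0]; have [i + yi] := Dneg _ Dy.
  rewrite ltnS leq_eqVlt => /orP[/eqP iE|ilt]; last by exists i.
  by move: yi; rewrite iE leNgt y0.
have [||t /andP[t0 t1] tD] := @convex_alternative2 R
    [set p | exists2 y, D y & p = (\sum_(i < n.+1) w i * y i, y n.+1)].
- move=> p q t [y Dy ->] [z Dz ->] t01 /=; eexists; first exact: Dconv Dy Dz t01.
  congr pair; rewrite !mulr_sumr -big_split/=; apply: eq_bigr => i _; ring.
- move=> p [y Dy ->]/=; have [y0|y0] := leP (y n.+1) 0; first by right.
  by left; apply: wD.
exists (fun i => if (i < n.+1)%N then (1 - t) * w i else t); split.
- by move=> i; case: ifPn => // _; rewrite mulr_ge0// subr_ge0.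
- rewrite big_ord_recr/= ltnn (eq_bigr (fun i : 'I_n.+1 => (1 - t) * w i)).
    by rewrite -mulr_sumr w1 mulr1 subrK.
  by move=> i _; rewrite ltn_ord.
- move=> y Dy; rewrite big_ord_recr/= ltnn.
  rewrite (eq_bigr (fun i : 'I_n.+1 => (1 - t) * (w i * y i))).
    by rewrite -mulr_sumr; apply: (tD (_, _)); exists y.
  by move=> i _; rewrite ltn_ord mulrA.
Qed.

Lemma compact_coverP (T : topologicalType) (A : set T) :
  compact A <-> cover_compact A.
Proof.
have [->|/set0P[p _]] := eqVneq A set0.
  split=> _; last exact: compact0.
  by move=> I D f _ _; exists fset0.
pose T' : ptopologicalType := HB.pack_for ptopologicalType T (isPointed.Build T p).
by have := @compact_cover T'; rewrite predeqE => /(_ A).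
Qed.

Lemma compact_nondecreasing_cover (T : topologicalType) (A : set T)
    (G : nat -> set T) : compact A -> (forall n, open (G n)) ->
  (forall m n, (m <= n)%N -> G m `<=` G n) ->
  A `<=` \bigcup_n G n -> exists n, A `<=` G n.
Proof.
move=> /compact_coverP cA oG ndG AG.
have [|E _ AE] := cA _ setT G (fun n _ => oG n); first by move=> x /AG.
exists (\max_(i <- enum_fset E) i)%N => x /AE[i /= iE Gx].
by apply: ndG Gx; rewrite (big_rem i)//= leq_maxl.
Qed.

Lemma ler_dist_max (R : realType) (a b c d : R) :
  `|Num.max a b - Num.max c d| <= `|a - c| + `|b - d|.
Proof.
have := ler_norm (a - c); have := ler_norm (- (a - c)).
have := ler_norm (b - d); have := ler_norm (- (b - d)).
rewrite !normrN ler_norml => ? ? ? ?.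
by have [?|?] := leP a b; have [?|?] := leP c d; apply/andP; split; lra.
Qed.

Section continuous_real_functions.
Context (R : realType) (T : topologicalType).
Implicit Types f g : T -> R.

Lemma continuous_cst (a : R) : continuous (fun _ : T => a).
Proof. by move=> x; exact: cvg_cst. Qed.

Lemma continuous_fun_add f g : continuous f -> continuous g ->
  continuous (fun x => f x + g x).
Proof. by move=> cf cg x; apply: cvgD; [exact: cf|exact: cg]. Qed.

Lemma continuous_fun_sub f g : continuous f -> continuous g ->
  continuous (fun x => f x - g x).
Proof. by move=> cf cg x; apply: cvgB; [exact: cf|exact: cg]. Qed.

Lemma continuous_fun_mul f g : continuous f -> continuous g ->
  continuous (fun x => f x * g x).
Proof. by move=> cf cg x; apply: cvgM; [exact: cf|exact: cg]. Qed.

Lemma continuous_fun_min f g : continuous f -> continuous g ->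
  continuous (fun x => Num.min (f x) (g x)).
Proof.
by move=> cf cg x; exact: (@continuous_min R T f g x (cf x) (cg x)).
Qed.

Lemma continuous_fun_max f g : continuous f -> continuous g ->
  continuous (fun x => Num.max (f x) (g x)).
Proof.
by move=> cf cg x; exact: (@continuous_max R T f g x (cf x) (cg x)).
Qed.

Lemma continuous_fun_sum (f : nat -> T -> R) n : (forall i, continuous (f i)) ->
  continuous (fun x => \sum_(i < n) f i x).
Proof.
move=> cf; elim: n => [|n IH].
  by under eq_fun do rewrite big_ord0; exact: continuous_cst.
under eq_fun do rewrite big_ord_recr/=.
exact: continuous_fun_add.
Qed.

Lemma open_lt_preimage f (a : R) : continuous f -> open [set x | a < f x].
Proof.
move=> cf; rewrite (_ : [set x | _] = f @^-1` [set y | a < y])//.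
by apply: open_comp => [x _|]; [exact: cf|exact: open_gt].
Qed.

End continuous_real_functions.

(** * Integrals of bounded functions *)

Section finite_measure_integral.
Context d (T : measurableType d) (R : realType).
Variables (m : {finite_measure set T -> \bar R}) (D : set T).
Hypothesis mD : measurable D.
Implicit Types f g : T -> R.

Lemma bounded_integrable f (M : R) : measurable_fun D f ->
  (forall x, D x -> `|f x| <= M) -> m.-integrable D (EFin \o f).
Proof.
move=> mf fM; apply: measurable_bounded_integrable => //.
  by rewrite ltey_eq fin_num_measure.
exists M; split; first exact: num_real.
by move=> y My x Dx /=; apply: (le_trans (fM _ Dx)); exact: ltW.
Qed.

Lemma unit_integrable f : measurable_fun D f ->
  (forall x, D x -> 0 <= f x <= 1) -> m.-integrable D (EFin \o f).
Proof.
move=> mf f01; apply: (@bounded_integrable _ 1) => // x /f01/andP[f0 f1].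
by rewrite ger0_norm.
Qed.

Lemma Rintegral_norm_le f (M : R) : measurable_fun D f ->
  (forall x, D x -> `|f x| <= M) ->
  `|\int[m]_(x in D) f x| <= M * fine (m D).
Proof.
move=> mf fM; have intf := bounded_integrable mf fM.
apply: (le_trans (le_normr_Rintegral mD intf)).
rewrite -Rintegral_cst//; apply: le_Rintegral => //.
- exact: integrable_norm.
- apply: (@bounded_integrable _ `|M|) => //.
Qed.

Lemma Rintegral_bounded_cvg (f_ : nat -> T -> R) f (M : R) :
  (forall n, measurable_fun D (f_ n)) ->
  (forall n x, D x -> `|f_ n x| <= M) ->
  (forall x, D x -> f_ ^~ x @ \oo --> f x) ->
  (fun n => \int[m]_(x in D) f_ n x) @ \oo --> \int[m]_(x in D) f x.
Proof.
move=> mf fM cf; have mlim : measurable_fun D f by exact: measurable_fun_cvg cf.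
have fb x : D x -> `|f x| <= M.
  move=> Dx;
  have cn : (fun n => `|f_ n x|) @ \oo --> `|f x| by apply: cvg_norm; exact: cf.
  rewrite -(cvg_lim _ cn)//.
  by apply: limr_le; [apply/cvg_ex; eexists; exact: cn|apply: nearW => n; exact: fM].
have [| | | | |ig _ cvi] := @dominated_convergence _ _ _ m D mD
  (fun n => EFin \o f_ n) (EFin \o f) (EFin \o cst M).
- by move=> n; exact/measurable_EFinP.
- exact/measurable_EFinP.
- by apply: aeW => x Dx; apply: cvg_EFin; [exact: nearW|exact: cf].
- by apply: (@bounded_integrable _ `|M|).
- by apply: aeW => x n Dx /=; rewrite lee_fin fM.
apply: fine_cvg; rewrite fineK//.
exact: (integrable_fin_num mD (bounded_integrable mlim fb)).
Unshelve. all: by end_near.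
Qed.

Lemma Rintegral_sum (f_ : nat -> T -> R) n :
  (forall i, (i < n)%N -> m.-integrable D (EFin \o f_ i)) ->
  \int[m]_(x in D) (\sum_(i < n) f_ i x) = \sum_(i < n) \int[m]_(x in D) f_ i x
  /\ m.-integrable D (EFin \o (fun x => \sum_(i < n) f_ i x)).
Proof.
elim: n => [|n IH] fi.
  rewrite big_ord0 (_ : (fun x => _) = cst 0); last first.
    by apply/funext => x; rewrite big_ord0.
  split; first by rewrite Rintegral_cst// mul0r.
  by apply: (@bounded_integrable _ 0) => // x _; rewrite normr0.
have [i lin|IH1 IH2] := IH; first by apply: fi; exact: ltnW.
rewrite (_ : (fun x => _) = (fun x => \sum_(i < n) f_ i x + f_ n x)); last first.
  by apply/funext => x; rewrite big_ord_recr.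
split; first by rewrite RintegralD// ?IH1 ?big_ord_recr//; exact: fi.
exact: (integrableD mD IH2 (fi n (leqnn _))).
Qed.

(** The sum is the smaller of [N] and the integer part of [z]. *)
Lemma layer_count (N : nat) (z : R) : 0 <= z ->
  (N%:R <= z -> \sum_(i < N) ((i.+1%:R <= z)%R%:R : R) = N%:R) /\
  (z <= N%:R -> z - 1 <= \sum_(i < N) ((i.+1%:R <= z)%R%:R : R) <= z).
Proof.
move=> z0; elim: N => [|N [IH1 IH2]].
  by rewrite big_ord0; split => // z0'; apply/andP; split; lra.
rewrite big_ord_recr/=; split => h.
  have hN : N%:R <= z by rewrite (le_trans _ h)// ler_nat.
  by rewrite IH1// h -natr1.
have [hN|hN] := leP N.+1%:R z.
  have -> : z = N.+1%:R by apply/eqP; rewrite eq_le h.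
  rewrite (_ : \sum_(i < N) _ = N%:R).
    by rewrite natr1; apply/andP; split; lra.
  rewrite -[RHS](IH1 _); last by rewrite (le_trans _ hN)// ler_nat.
  by apply: eq_bigr => i _; rewrite (le_trans _ hN)// !ler_nat ltnS ltnW.
rewrite addr0; have [zN|zN] := leP z N%:R; first exact: IH2.
rewrite IH1; last exact: ltW.
by move: hN; rewrite -natr1 => hN; apply/andP; split; lra.
Qed.

(** By [layer_count] at [n.+1 * f x], the mean of the indicators of the level sets is within
    [1 / n.+1] of [f] pointwise. The bound carries facts about values on sets over to integrals: in
    Riesz' theorem, for linearity of integration in the measure, and for barycentres. *)
Lemma layer_cake f n : measurable_fun D f ->
  (forall x, D x -> 0 <= f x <= 1) ->
  `|\int[m]_(x in D) f x - n.+1%:R^-1 * \sum_(i < n.+1)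
     fine (m (D `&` [set x | i.+1%:R / n.+1%:R <= f x]))|
  <= n.+1%:R^-1 * fine (m D).
Proof.
move=> mf f01; pose N : R := n.+1%:R.
have N0 : 0 < N by rewrite ltr0n.
pose A (i : nat) := D `&` [set x | i.+1%:R / N <= f x].
have mA i : measurable (A i).
  rewrite /A (_ : [set x | _ <= f x] = f @^-1` `[i.+1%:R / N, +oo[).
    by apply: mf => //; exact: measurable_itv.
  by apply/seteqP; split => x /=; rewrite in_itv/= andbT.
have iA i : m.-integrable D (EFin \o \1_(A i)).
  apply: (@bounded_integrable _ 1) => [|x _]; first exact: measurable_indic.
  by rewrite indicE; case: (_ \in _); rewrite ?normr0 ?normr1.
have [S1 S2] := @Rintegral_sum (fun i => \1_(A i)) n.+1 (fun i _ => iA i).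
have -> : N^-1 * \sum_(i < n.+1) fine (m (A i)) =
    \int[m]_(x in D) (N^-1 * \sum_(i < n.+1) \1_(A i) x).
  rewrite RintegralZl// S1; congr *%R; apply: eq_bigr => i _.
  rewrite /Rintegral integral_indic//; congr (fine (m _)).
  by rewrite setIC setIA setIid.
have iS : m.-integrable D (EFin \o (fun x => N^-1 * \sum_(i < n.+1) \1_(A i) x)).
  exact: (integrableZl mD _ S2).
have if_ := unit_integrable mf f01.
rewrite -RintegralB//; apply: Rintegral_norm_le => [|x Dx].
  apply/measurable_EFinP; apply: (measurable_int m).
  exact: (integrableB mD if_ iS).
have [//|_ h] := @layer_count n.+1 (f x * N).
  by rewrite mulr_ge0 ?(ltW N0)//; have /andP[] := f01 _ Dx.
have /h : f x * N <= N by have /andP[_ ?] := f01 _ Dx; nra.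
rewrite (eq_bigr (fun i : 'I_n.+1 => \1_(A i) x)) => [/andP[h1 h2]|i _]; last first.
  rewrite -ler_pdivrMr// indicE; congr (_%:R); congr nat_of_bool.
  by apply/idP/idP => [?|/set_mem[]//]; apply/mem_set.
rewrite -(ler_pM2r N0) mulVf ?gt_eqF// -[X in _ * X]gtr0_norm// -normrM.
rewrite mulrBl mulrAC mulVf ?gt_eqF// mul1r ler_norml; apply/andP; split; lra.
Qed.

End finite_measure_integral.

(** * Decreasing convex families of functions and their suprema *)

Definition unit_measurable d (T : measurableType d) (R : realType) : set (T -> R) :=
  [set f : T -> R | measurable_fun setT f /\ forall x, 0 <= f x <= 1].
Arguments unit_measurable {d} T R.

Section going_up.
Context d (T : measurableType d) (R : realType).
Variable m : {finite_measure set T -> \bar R}.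
Implicit Types f g : T -> R.

Lemma unit_sqr_integrable f : unit_measurable T R f ->
  m.-integrable setT (EFin \o (fun x => f x ^+ 2)).
Proof.
move=> [mf f01]; apply: unit_integrable => //; first exact: measurable_funX.
by move=> x _; have /andP[? ?] := f01 x; rewrite sqr_ge0 expr_le1.
Qed.

Lemma unit_normB_integrable f g : unit_measurable T R f -> unit_measurable T R g ->
  m.-integrable setT (EFin \o (fun x => `|f x - g x|)).
Proof.
move=> [mf f01] [mg g01]; apply: unit_integrable => //.
  by apply: measurableT_comp => //; exact: measurable_funB.
move=> x _; have /andP[? ?] := f01 x; have /andP[? ?] := g01 x.
by rewrite normr_ge0/= ler_norml; apply/andP; split; lra.
Qed.

(* Parallelogram identity in L^2, then [2 `|a| <= t + a ^+ 2 / t]. *)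
Lemma parallelogram_L1 f g c a t : unit_measurable T R f -> unit_measurable T R g ->
  0 < t -> \int[m]_x f x ^+ 2 <= c + a -> \int[m]_x g x ^+ 2 <= c + a ->
  c - a <= \int[m]_x ((f x + g x) / 2) ^+ 2 ->
  \int[m]_x `|f x - g x| <= t * fine (m setT) + 8 * a / t.
Proof.
move=> uf ug t0 fc gc fgc.
have ufg : unit_measurable T R (fun x => (f x + g x) / 2).
  split; first by apply: measurable_funM => //; apply: measurable_funD; [exact: uf.1|exact: ug.1].
  move=> x; have /andP[? ?] := uf.2 x; have /andP[? ?] := ug.2 x.
  by apply/andP; split; lra.
have If := unit_sqr_integrable uf.
have Ig := unit_sqr_integrable ug.
have Ifg := unit_sqr_integrable ufg.
have It : m.-integrable setT (EFin \o cst t).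
  by apply: (@bounded_integrable _ _ _ _ _ _ _ `|t|).
have I1 := integrableZl measurableT (2 / t) If.
have I2 := integrableZl measurableT (2 / t) Ig.
have I3 := integrableZl measurableT (4 / t) Ifg.
have I12 := integrableD measurableT I1 I2.
have I123 := integrableB measurableT I12 I3.
have I := integrableD measurableT It I123.
have : \int[m]_x `|f x - g x| <=
    \int[m]_x (t + (2 / t * f x ^+ 2 + 2 / t * g x ^+ 2 - 4 / t * ((f x + g x) / 2) ^+ 2)).
  apply: le_Rintegral => //; first exact: unit_normB_integrable.
  move=> x _.
  rewrite [leRHS](_ : _ = t + (f x - g x) ^+ 2 / t); last by field; rewrite gt_eqF.
  rewrite -(ler_pM2r t0) mulrDl divfK ?gt_eqF// -real_normK ?num_real//.
  by have := normr_ge0 (f x - g x); nra.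
rewrite RintegralD// RintegralB// RintegralD// !RintegralZl// Rintegral_cst//.
move/le_trans; apply; rewrite lerD2l -mulrDr.
set F := Rintegral _ _ _ in fc *; set G := Rintegral _ _ _ in gc *.
set H := Rintegral _ _ _ in fgc *.
(* The three hypotheses bound the numerator by [4 (c + a) - 4 (c - a) = 8 a]. *)
have -> : 2 / t * (F + G) - 4 / t * H = (2 * (F + G) - 4 * H) / t by field; rewrite gt_eqF.
by rewrite ler_pM2r ?invr_gt0//; lra.
Qed.

Variable FF : nat -> set (T -> R).
Hypothesis FF_unit : forall n, FF n `<=` unit_measurable T R.
Hypothesis FF_decr : forall n p, (n <= p)%N -> FF p `<=` FF n.
Hypothesis FF_mid : forall n f g, FF n f -> FF n g -> FF n (fun x => (f x + g x) / 2).
Hypothesis FF_up : forall n f g, FF n f -> unit_measurable T R g ->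
  (forall x, f x <= g x) -> FF n g.

(* Near-minimal elements of the decreasing convex families [FF n] form an
   L^2-Cauchy sequence, so the supremum of a thin subsequence, which lies in
   every [FF n], is not much bigger than its first term. *)
Lemma going_up (r e : R) : 0 < e ->
  (forall n, exists2 f, FF n f & \int[m]_x f x ^+ 2 <= r) ->
  exists2 f, (forall n, FF n f) & \int[m]_x f x ^+ 2 <= r + e.
Proof.
move=> e0 FFr.
pose S n := [set \int[m]_x f x ^+ 2 | f in FF n].
pose c n := inf (S n).
have Slb n : has_lbound (S n).
  by exists 0 => _ [f _ <-]; apply: Rintegral_ge0 => x _; exact: sqr_ge0.
have Sinf n : has_inf (S n).
  by split => //; have [f Ff _] := FFr n; exists (\int[m]_x f x ^+ 2), f.
have cle n f : FF n f -> c n <= \int[m]_x f x ^+ 2.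
  by move=> Ff; apply: ge_inf => //; exists f.
have cr n : c n <= r.
  by have [f Ff fr] := FFr n; exact: le_trans (cle _ _ Ff) fr.
have cnd n p : (n <= p)%N -> c n <= c p.
  move=> np; apply: lb_le_inf; first by have [] := Sinf p.
  by move=> _ [f Ff <-]; apply: cle; exact: FF_decr Ff.
have supc : has_sup (range c) by split; [exists (c 0%N), 0%N|exists r => _ [n _ <-]].
pose C := sup (range c).
have cC n : c n <= C by apply: ub_le_sup; [exact: supc.2|exists n].
have Cr : C <= r by apply: ge_sup; [exact: supc.1|move=> _ [n _ <-]].
pose M := fine (m setT) + 8.
have M0 : 0 < M by rewrite ltr_wpDl// fine_ge0.
(* The excess over [r] will be at most [a 0 + 4 k M]. Here [4 k M <= e / 2], and
   [a 0 = k ^ 2 <= k <= e / (8 M)], which is at most [e / 2] because [8 <= M]. *)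
pose k : R := Num.min 1 (e / (8 * M)).
have k0 : 0 < k by rewrite lt_min ltr01 divr_gt0// mulr_gt0.
pose t j : R := k * 2^-1 ^+ j.
have t0 j : 0 < t j by rewrite mulr_gt0// exprn_gt0.
(* With [a = t ^ 2] the term [8 a / t] of [parallelogram_L1] becomes [8 t], so consecutive terms are
   within [t j * M] in L^1, which is summable. *)
pose a j : R := t j ^+ 2.
have a0 j : 0 < a j by rewrite exprn_gt0.
have aS j : a j.+1 <= a j.
  apply: lerXn2r; rewrite ?nnegrE; [exact: ltW|exact: ltW|].
  rewrite /t ler_pM2l// exprS ler_piMl// ?exprn_ge0//.
  by rewrite invf_le1// ler1n.
have /choice[q qP] : forall j, exists nf : nat * (T -> R),
    [/\ (j <= nf.1)%N, C - a j <= c nf.1, FF nf.1 nf.2 &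
        \int[m]_x nf.2 x ^+ 2 <= C + a j].
  move=> j; have [_ [n _ <-] Cn] := sup_adherent (a0 j) supc.
  pose p := maxn n j.
  have [_ [f Ff <-] fp] := inf_adherent (a0 j) (Sinf p).
  exists (p, f); split => //=; first exact: leq_maxr.
    by rewrite (le_trans (ltW Cn))// cnd// leq_maxl.
  by apply: (le_trans (ltW fp)); rewrite lerD2r; exact: cC.
pose f j := (q j).2.
have uf j : unit_measurable T R (f j) by have [_ _ + _] := qP j; exact: FF_unit.
have f01 j x : 0 <= f j x <= 1 := (uf j).2 x.
have fS j : \int[m]_x `|f j x - f j.+1 x| <= t j * M.
  apply: le_trans (@parallelogram_L1 (f j) (f j.+1) C (a j) (t j) _ _ _ _ _ _) _ => //.
  - by have [] := qP j.
  - by have [_ _ _ h] := qP j.+1; rewrite (le_trans h)// lerD2l.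
  (* The midpoint lies in the family with the smaller of the two indices, and the infimum over that
     family is at least [C - a j] in either case. *)
  - have [_ h1 h2 _] := qP j; have [_ h3 h4 _] := qP j.+1.
    have [h|h] := leqP (q j).1 (q j.+1).1.
      by apply: (le_trans h1); apply: cle; apply: FF_mid => //; exact: FF_decr h4.
    apply: (@le_trans _ _ (c (q j.+1).1)).
      by rewrite (le_trans _ h3)// lerD2l lerN2.
    by apply: cle; apply: FF_mid => //; apply: FF_decr h2; exact: ltnW.
  - rewrite /M mulrDr lerD2l /a expr2 mulrA mulfK ?gt_eqF//.
    by rewrite mulrC.
pose g := fix g J : T -> R :=
  if J is J'.+1 then (fun x => Num.max (g J' x) (f J x)) else f 0%N.
have ug J : unit_measurable T R (g J).
  elim: J => [|J [IH1 IH2]]; first exact: uf.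
  split; first by apply: measurable_maxr => //; exact: (uf J.+1).1.
  move=> x /=; have /andP[? ?] := IH2 x; have /andP[? ?] := f01 J.+1 x.
  by rewrite le_max ge_max; apply/andP; split; apply/orP + apply/andP; auto.
have fg j J x : (j <= J)%N -> f j x <= g J x.
  elim: J => [|J IH]; first by rewrite leqn0 => /eqP ->.
  by rewrite leq_eqVlt /= le_max => /predU1P[->|/IH ->//]; rewrite lexx orbT.
have gle J x : g J x <= f 0%N x + \sum_(j < J) `|f j x - f j.+1 x| /\
               f J x <= f 0%N x + \sum_(j < J) `|f j x - f j.+1 x|.
  elim: J => [|J [IH1 IH2]]; first by rewrite big_ord0 addr0.
  rewrite big_ord_recr/= addrA ge_max.
  have h : f J.+1 x <= f 0%N x + \sum_(j < J) `|f j x - f j.+1 x| + `|f J x - f J.+1 x|.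
    by have := ler_norm (- (f J x - f J.+1 x)); rewrite normrN; lra.
  by rewrite h andbT; split => //; rewrite (le_trans IH1)// lerDl.
have sumt J : \sum_(j < J) t j = 2 * k - 2 * t J.
  elim: J => [|J IH]; first by rewrite big_ord0 /t expr0 mulr1 subrr.
  by rewrite big_ord_recr/= IH /t exprS; field.
have Ig J : \int[m]_x g J x ^+ 2 <= r + e.
  have [S1 S2] := @Rintegral_sum _ _ _ m setT measurableT
    (fun j x => `|f j x - f j.+1 x|) J (fun j _ => unit_normB_integrable (uf j) (uf j.+1)).
  have I0 := unit_sqr_integrable (uf 0%N).
  have I2 := integrableZl measurableT 2 S2.
  (* Both functions take values in [0, 1] and [f 0 <= g J], so [g J ^ 2 - f 0 ^ 2 <= 2 (g J - f 0)],
     and [gle] bounds the difference by the sum of increments. *)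
  have : \int[m]_x g J x ^+ 2 <=
      \int[m]_x (f 0%N x ^+ 2 + 2 * \sum_(j < J) `|f j x - f j.+1 x|).
    apply: le_Rintegral => //; first exact: unit_sqr_integrable.
      exact: (integrableD measurableT I0 I2).
    move=> x _; have [h _] := gle J x.
    have /andP[? ?] := (ug J).2 x; have /andP[? ?] := f01 0%N x.
    have := fg 0%N J x (leq0n _); nra.
  rewrite RintegralD// RintegralZl// S1 => /le_trans; apply.
  have h : \sum_(j < J) \int[m]_x `|f j x - f j.+1 x| <= 2 * k * M.
    apply: (@le_trans _ _ (\sum_(j < J) (t j * M))); first by apply: ler_sum => j _.
    rewrite -mulr_suml sumt ler_pM2r//.
    by have := t0 J; lra.
  have [_ _ _ h0] := qP 0%N.
  have k1 : k <= 1 by rewrite ge_min lexx.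
  have : a 0%N = k ^+ 2 by rewrite /a /t expr0 mulr1.
  have : k <= e / (8 * M) by rewrite ge_min lexx orbT.
  rewrite ler_pdivlMr ?mulr_gt0//.
  have M4 : 8 <= M by rewrite lerDr fine_ge0.
  rewrite -/(f 0%N) in h0; nra.
pose F x := sup (range (g ^~ x)).
have gb x : has_ubound (range (g ^~ x)).
  by exists 1 => _ [J _ <-]; have /andP[] := (ug J).2 x.
have gF x : g ^~ x @ \oo --> F x.
  apply: nondecreasing_cvgn => //; apply/nondecreasing_seqP => n /=.
  by rewrite le_max lexx.
have uF : unit_measurable T R F.
  split; first by apply: (measurable_fun_cvg (h := g)) => // n; exact: (ug n).1.
  move=> x; apply/andP; split.
    apply: (@le_trans _ _ (g 0%N x)); first by have /andP[] := (ug 0%N).2 x.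
    by apply: ub_le_sup => //; exists 0%N.
  apply: ge_sup; first by exists (g 0%N x), 0%N.
  by move=> _ [J _ <-]; have /andP[] := (ug J).2 x.
exists F.
  move=> n; have [nq _ h _] := qP n; apply: FF_up (FF_decr nq h) uF _ => x.
  apply: (@le_trans _ _ (g n x)); first exact: fg.
  by apply: ub_le_sup => //; exists n.
have cvI : (fun J => \int[m]_x g J x ^+ 2) @ \oo --> \int[m]_x F x ^+ 2.
  apply: (@Rintegral_bounded_cvg _ _ _ m setT measurableT _ _ 1).
  - by move=> n; apply: measurable_funX; exact: (ug n).1.
  - move=> n x _; have /andP[? ?] := (ug n).2 x.
    by rewrite ger0_norm ?sqr_ge0// expr_le1.
  - by move=> x _; rewrite expr2; under eq_fun do rewrite expr2; apply: cvgM.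
rewrite -(cvg_lim _ cvI)//; apply: limr_le; last exact: nearW.
by apply/cvg_ex; eexists; exact: cvI.
Qed.
End going_up.

(** * Riesz representation on a compact set *)

Lemma measurable_fun_rays d (T : measurableType d) (R : realType) (D : set T)
    (f : T -> R) : measurable D ->
  (forall c, measurable (D `&` [set x | c < f x])) -> measurable_fun D f.
Proof.
move=> mD mf _; apply: (measurability _ (RGenOInfty.measurableE R)) => //.
move=> _ [_ [c ->] <-]; rewrite (_ : f @^-1` _ = [set x | c < f x])//.
by apply/seteqP; split => x /=; rewrite in_itv/= andbT.
Qed.

Section riesz.
Context (R : realType) (T : topologicalType) (K : set T) (I : (T -> R) -> R).
Hypothesis K_compact : compact K.
Hypothesis I_linear : forall (f g : T -> R) a b, continuous f -> continuous g ->
  I (fun x => a * f x + b * g x) = a * I f + b * I g.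
Hypothesis I_ge0 : forall f : T -> R, continuous f -> (forall x, K x -> 0 <= f x) -> 0 <= I f.
Hypothesis I1 : I (fun=> 1) = 1.

Let I_le (f g : T -> R) : continuous f -> continuous g -> (forall x, K x -> f x <= g x) ->
  I f <= I g.
Proof.
move=> cf cg fg; rewrite -subr_ge0.
have <- : I (fun x => 1 * g x + (- 1) * f x) = I g - I f.
  by rewrite I_linear// mul1r mulN1r.
apply: I_ge0 => [|x Kx]; last by rewrite mul1r mulN1r subr_ge0 fg.
by apply: continuous_fun_add; apply: continuous_fun_mul => //; exact: continuous_cst.
Qed.

Let I0 : I (fun=> 0) = 0.
Proof.
by have := @I_linear _ _ 0 0 (@continuous_cst R T 0) (@continuous_cst R T 0); rewrite !mul0r !addr0.
Qed.

Let I_sum (f : nat -> T -> R) n : (forall i, continuous (f i)) ->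
  I (fun x => \sum_(i < n) f i x) = \sum_(i < n) I (f i).
Proof.
move=> cf; elim: n => [|n IH].
  by rewrite big_ord0; under eq_fun do rewrite big_ord0; exact: I0.
have -> : (fun x => \sum_(i < n.+1) f i x) =
    (fun x => 1 * \sum_(i < n) f i x + 1 * f n x).
  by apply/funext => x; rewrite big_ord_recr/= !mul1r.
rewrite I_linear ?IH ?big_ord_recr/= ?mul1r//; exact: continuous_fun_sum.
Qed.

(* Covers are increasing sequences rather than countable sums, so that countable
   subadditivity of the outer measure [rho] involves no double series. *)
Let covers (E : set T) (f : nat -> T -> R) := [/\ forall n, continuous (f n),
  forall n x, 0 <= f n x, forall n x, f n x <= f n.+1 x &
  forall x, K x -> E x -> exists n, 1 <= f n x].

Let S (E : set T) := [set r | exists2 f, covers E f & forall n, I (f n) <= r].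

Let covers_nd E f n p x : covers E f -> (n <= p)%N -> f n x <= f p x.
Proof.
move=> [_ _ ndf _] np; have /nondecreasing_seqP : forall n, f^~ x n <= f^~ x n.+1.
  by move=> k; exact: ndf.
by apply.
Qed.

Let S1 E : S E 1.
Proof.
exists (fun _ _ => 1); last by move=> _; rewrite I1.
by split => //; [move=> _; exact: continuous_cst|move=> x _ _; exists 0%N].
Qed.

Let S_ge0 E r : S E r -> 0 <= r.
Proof. by move=> [f [cf f0 _ _] /(_ 0%N)]; apply: le_trans; exact: I_ge0. Qed.

Let rho (E : set T) : R := inf (S E).

Let rho_le E r : S E r -> rho E <= r.
Proof. by move=> Sr; apply: ge_inf => //; exists 0 => q; exact: S_ge0. Qed.

Let rho_inf E : has_inf (S E).
Proof. by split; [exists 1; exact: S1|exists 0 => q; exact: S_ge0]. Qed.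

Let rho_ge E r : (forall q, S E q -> r <= q) -> r <= rho E.
Proof. by move=> h; apply: lb_le_inf => //; exists 1; exact: S1. Qed.

Let rho_ge0 E : 0 <= rho E. Proof. by apply: rho_ge => q; exact: S_ge0. Qed.

Let rho0 E : (forall x, K x -> ~ E x) -> rho E = 0.
Proof.
move=> KE; apply/eqP; rewrite eq_le rho_ge0 andbT; apply: rho_le.
exists (fun _ _ => 0); last by move=> _; rewrite I0.
by split => //; [move=> _; exact: continuous_cst|move=> x /KE].
Qed.

Let rho_mono E F : (forall x, K x -> E x -> F x) -> rho E <= rho F.
Proof.
move=> EF; apply: rho_ge => q [f [cf f0 fS fF] fq]; apply: rho_le.
by exists f => //; split => // x Kx Ex; apply: fF => //; exact: EF.
Qed.

Let rho_sigma_subadditive : sigma_subadditive (fun E => (rho E)%:E).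
Proof.
move=> F; have Fge0 k : (0 <= (rho (F k))%:E)%E by rewrite lee_fin.
set L := (\sum_(k <oo) _)%E.
have [->|Ltop] := eqVneq L +oo%E; first by rewrite leey.
have Lfin : L \is a fin_num.
  by rewrite ge0_fin_numE ?lt_neqAle ?Ltop ?leey//; exact: nneseries_ge0.
rewrite -(fineK Lfin) lee_fin; apply/ler_addgt0Pr => e e0.
have ek k : 0 < e / 2 ^+ k.+1 by rewrite divr_gt0// exprn_gt0.
have /choice[f fP] : forall k, exists f, covers (F k) f /\
    forall n, I (f n) <= rho (F k) + e / 2 ^+ k.+1.
  move=> k; have [q [f cf fq] qr] := inf_adherent (ek k) (rho_inf (F k)).
  by exists f; split => // n; rewrite (le_trans (fq n))// ltW.
have cf k n : continuous (f k n) by have [[]] := fP k.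
(* A diagonal choice: stage [n] uses the [n]-th functions of the first [n] covers, so every stage is
   a finite sum of continuous functions. It increases with [n] both by new terms and by growth of
   the old ones. *)
apply: rho_le; exists (fun n x => \sum_(k < n) f k n x).
  split.
  - by move=> n; apply: (@continuous_fun_sum R T (fun k => f k n)) => k; exact: cf.
  - by move=> n x; apply: sumr_ge0 => k _; have [[_ + _ _] _] := fP k; apply.
  - move=> n x; rewrite big_ord_recr/= ler_wpDr//; first by have [[_ f0 _ _] _] := fP n; apply: f0.
    by apply: ler_sum => k _; have [[_ _ + _] _] := fP k; apply.
  - move=> x Kx [k _ Fk]; have [c _] := fP k; have [_ _ _ /(_ _ Kx Fk)[n fn]] := c.
    exists (maxn n k.+1); have kn : (k < maxn n k.+1)%N by rewrite leq_maxr.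
    rewrite (bigD1 (Ordinal kn))//= ler_wpDr//.
      by apply: sumr_ge0 => i _; have [[_ + _ _] _] := fP i; apply.
    by rewrite (le_trans fn)//; apply: (covers_nd _ c); exact: leq_maxl.
move=> n; rewrite (I_sum n (fun k => cf k n)).
apply: (@le_trans _ _ (\sum_(k < n) (rho (F k) + e / 2 ^+ k.+1))).
  by apply: ler_sum => k _; have [_ +] := fP k; apply.
rewrite big_split/= lerD//.
  rewrite -lee_fin fineK// -sumEFin.
  have := nneseries_lim_ge n (fun k (_ : (0 <= k)%N) (_ : xpredT k) => Fge0 k).
  by rewrite big_mkord.
have -> : \sum_(k < n) e / 2 ^+ k.+1 = e - e / 2 ^+ n.
  elim: n => [|n IH]; first by rewrite big_ord0 expr0 divr1 subrr.
  by rewrite big_ord_recr/= IH exprS; field; rewrite expf_neq0.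
by rewrite gerBl divr_ge0 ?exprn_ge0// ltW.
Qed.

(* With [e n = min 1 (n g)] increasing to the indicator of [{g > 0}], a cover
   [f] of [E] splits into the cover [f * e] of the part inside [{g > 0}] and,
   for each fixed [k], the cover [f * (1 - e k)] of the part outside. *)
Let rho_caratheodory (g : T -> R) E : continuous g ->
  rho (E `&` [set x | 0 < g x]) + rho (E `&` ~` [set x | 0 < g x]) <= rho E.
Proof.
move=> cg; apply: rho_ge => q [f cvf fq]; have [cf f0 fS fE] := cvf.
pose e n x : R := Num.min 1 (n%:R * Num.max 0 (g x)).
have ce n : continuous (e n).
  apply: continuous_fun_min; first exact: continuous_cst.
  apply: continuous_fun_mul; first exact: continuous_cst.
  by apply: continuous_fun_max => //; exact: continuous_cst.
have g0 x : 0 <= Num.max 0 (g x) by rewrite le_max lexx.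
have e0 n x : 0 <= e n x by rewrite le_min ler01 mulr_ge0.
have e1 n x : e n x <= 1 by rewrite ge_min lexx.
have end_ n p x : (n <= p)%N -> e n x <= e p x.
  by move=> np; rewrite /e le_min2// ler_wpM2r// ler_nat.
have cfe n p : continuous (fun x => f n x * e p x) by exact: continuous_fun_mul.
have I_fe n p : I (fun x => f n x * (1 - e p x)) = I (f n) - I (fun x => f n x * e p x).
  rewrite -[I (f n)]mul1r -mulN1r -I_linear//; congr I; apply/funext => x; ring.
pose a n := I (fun x => f n x * e n x).
have rho_in r : (forall n, a n <= r) -> rho (E `&` [set x | 0 < g x]) <= r.
  move=> ar; apply: rho_le; exists (fun n x => f n x * e n x) => //; split => //.
  - by move=> n x; rewrite mulr_ge0.
  - by move=> n x; rewrite ler_pM// end_.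
  - move=> x Kx [Ex gx]; have [n fn] := fE _ Kx Ex.
    have gx0 : Num.max 0 (g x) = g x by rewrite max_r// ltW.
    pose p := maxn n (Num.truncn (g x)^-1).+1; exists p.
    have -> : e p x = 1.
      rewrite /e gx0 min_l// -ler_pdivrMr// div1r.
      apply: (@le_trans _ _ (Num.truncn (g x)^-1).+1%:R).
        by rewrite ltW// truncnS_gt.
      by rewrite ler_nat leq_maxr.
    by rewrite mulr1 (le_trans fn)//; apply: (covers_nd _ cvf); exact: leq_maxl.
have rho_out k : rho (E `&` ~` [set x | 0 < g x]) <= q - a k.
  apply: rho_le; exists (fun n x => f (maxn n k) x * (1 - e k x)).
    split => //.
    - move=> n; apply: continuous_fun_mul => //; apply: continuous_fun_sub => //.
      exact: continuous_cst.
    - by move=> n x; rewrite mulr_ge0// subr_ge0.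
    - move=> n x; rewrite ler_wpM2r ?subr_ge0//; apply: (covers_nd _ cvf).
      by rewrite geq_max leq_maxr andbT leq_max leqnSn.
    - move=> x Kx [Ex /negP]; rewrite -leNgt => gx; have [n fn] := fE _ Kx Ex.
      exists n; have -> : e k x = 0.
        by rewrite /e max_l// mulr0 min_r.
      by rewrite subr0 mulr1 (le_trans fn)//; apply: (covers_nd _ cvf); exact: leq_maxl.
  move=> n; rewrite I_fe lerB//.
  apply: I_le => // x _; rewrite ler_wpM2r//; apply: (covers_nd _ cvf); exact: leq_maxr.
rewrite -lerBrDr; apply: rho_in => n; rewrite lerBrDr addrC -lerBrDr.
exact: rho_out.
Qed.

(** As in Dini's theorem, compactness yields one function of the increasing cover that exceeds
    [1 - e] on all of [K], and positivity of [I] does the rest. *)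
Let rho_K1 : rho K = 1.
Proof.
apply/eqP; rewrite eq_le; apply/andP; split; first by apply: rho_le; exact: S1.
apply: rho_ge => q [f cvf fq]; have [cf f0 fS fE] := cvf.
apply/ler_addgt0Pr => e e0.
have [n Kn] : exists n, K `<=` [set x | 1 - e < f n x].
  apply: compact_nondecreasing_cover => // [n|n p np x /=|x Kx].
  - exact: open_lt_preimage.
  - by move=> /lt_le_trans; apply; exact: (covers_nd _ cvf np).
  - by have [n fn] := fE _ Kx Kx; exists n => //=; lra.
apply: (@le_trans _ _ (I (f n) + e)); last by rewrite lerD2r.
have <- : I (fun x => 1 * 1 + (- e) * 1) + e = 1.
  rewrite (@I_linear (fun=> 1) (fun=> 1)) ?I1; [|exact: continuous_cst|exact: continuous_cst].
  by rewrite !mulr1 subrK.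
rewrite lerD2r; apply: I_le => // [|x /Kn /= h]; first exact: continuous_cst.
by rewrite !mulr1 ltW.
Qed.

(** The [i]-th term is the part of [y] between the heights [i / N.+1] and [i.+1 / N.+1]. Such slices
    cut a function into continuous pieces, one for each level set of [layer_cake]. *)
Let layer_sum (y : R) (N n : nat) : 0 <= y ->
  \sum_(i < n) Num.min N.+1%:R^-1 (Num.max 0 (y - i%:R / N.+1%:R)) =
  Num.min (n%:R / N.+1%:R) y.
Proof.
move=> y0; elim: n => [|n IH]; first by rewrite big_ord0 mul0r min_l.
rewrite big_ord_recr/= IH -[n.+1%:R]natr1 mulrDl mul1r.
set a := _ / _; set b := N.+1%:R^-1.
have b0 : 0 < b by rewrite invr_gt0 ltr0n.
have a0 : 0 <= a by rewrite divr_ge0.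
have [ya|ay] := leP y a.
  rewrite (max_l (_ : y - a <= 0)) ?subr_le0// (min_r (ltW b0)) addr0.
  by rewrite min_r// (le_trans ya)// lerDl ltW.
rewrite max_r ?subr_ge0 ?ltW//; have [yab|bya] := leP (y - a) b.
  by rewrite addrC subrK min_r// -lerBlDl.
by rewrite min_l// -lerBrDl ltW.
Qed.

(* [U] is [T] with the Caratheodory sigma-algebra and [ev] retracts it onto [K],
   outside of which the representing measure vanishes. *)
Lemma riesz : exists (d : measure_display) (U : measurableType d)
    (P : {finite_measure set U -> \bar R}) (ev : U -> T),
  [/\ P setT = 1%E, forall u, K (ev u),
      forall f : T -> R, continuous f -> measurable_fun setT (f \o ev) &
      forall f : T -> R, continuous f -> \int[P]_u f (ev u) = I f].
Proof.
have [k0 Kk0] : K !=set0.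
  apply/set0P/eqP => K0; have := rho_K1; rewrite rho0 => [/esym/eqP|x].
    by rewrite oner_eq0.
  by rewrite K0.
pose T0 : pointedType := HB.pack_for pointedType T (isPointed.Build T k0).
pose mu0 : set T0 -> \bar R := fun E => (rho E)%:E.
have mu00 : mu0 set0 = 0%E by congr EFin; apply: rho0 => x _ [].
have mu0ge0 E : (0 <= mu0 E)%E by rewrite lee_fin.
have mu0le : {homo mu0 : A B / A `<=` B >-> (A <= B)%E}.
  by move=> A B AB; rewrite lee_fin; apply: rho_mono => x _; exact: AB.
pose mu : {outer_measure set T0 -> \bar R} := HB.pack_for (outer_measure R T0) mu0
  (isOuterMeasure.Build R T0 mu0 mu00 mu0ge0 mu0le rho_sigma_subadditive).
pose U : measurableType _ := caratheodory_type mu.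
pose P0 : {measure set U -> \bar R} := mu.
have P0fin : fin_num_fun P0 by [].
pose P : {finite_measure set U -> \bar R} :=
  HB.pack_for {finite_measure set U -> \bar R} (P0 : set U -> \bar R) P0
   (Measure_isFinite.Build _ _ _ (P0 : set U -> \bar R) P0fin).
have PE A : P A = (rho A)%:E by [].
have mcara A : (forall E, rho (E `&` A) + rho (E `&` ~` A) <= rho E) ->
    measurable (A : set U).
  move=> h; apply: (@le_caratheodory_measurable R T0 mu) => E.
  by rewrite -EFinD lee_fin h.
have mK : measurable (K : set U).
  apply: mcara => E; rewrite [X in _ + X]rho0 ?addr0; last by move=> x Kx [].
  by apply: rho_mono => x _ [].
have mpos (f : T -> R) c : continuous f -> measurable ([set x | c < f x] : set U).
  move=> cf; apply: mcara => E.
  have := rho_caratheodory E (continuous_fun_sub cf (@continuous_cst R T c)).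
  rewrite (_ : [set x | 0 < f x - c] = [set x | c < f x])//.
  by apply/funext => x /=; rewrite subr_gt0.
pose ev (u : U) : T := if `[< K u >] then u else k0.
have evK u : K (ev u) by rewrite /ev; case: asboolP.
have evE u : K u -> ev u = u by rewrite /ev => /asboolP ->.
have mev (f : T -> R) : continuous f -> measurable_fun setT (f \o ev).
  move=> cf; apply: measurable_fun_rays => // c; rewrite setTI.
  rewrite (_ : [set _ | _] = ((K : set U) `&` [set x | c < f x]) `|`
      (~` (K : set U) `&` (if c < f k0 then setT else set0))).
    apply: measurableU; apply: measurableI => //; [exact: mpos|exact: measurableC|].
    by case: ifP.
  apply/seteqP; split => u /=; rewrite /ev; case: asboolP => Ku.
  - by left.
  - by move=> ->; right.
  - by case=> [[]//|[]].
  - by case=> [[]//|[_]]; case: ifP.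
have PT : P setT = 1%E.
  rewrite PE; congr EFin; apply/eqP; rewrite eq_le rho_le; last exact: S1.
  by rewrite -rho_K1 rho_mono.
have fPT : fine (P setT) = 1 by rewrite PT.
have unit_le (f : T -> R) : continuous f -> (forall x, K x -> 0 <= f x <= 1) ->
    \int[P]_u f (ev u) <= I f.
  move=> cf f01; apply/ler_addgt0Pr => e e0.
  pose n := Num.truncn e^-1; pose N : R := n.+1%:R.
  have N0 : 0 < N by rewrite ltr0n.
  have Ne : N^-1 <= e by rewrite invf_ple ?posrE// ltW// truncnS_gt.
  have := @layer_cake _ _ _ P setT measurableT (f \o ev) n (mev _ cf)
    (fun u _ => f01 _ (evK u)).
  rewrite fPT mulr1 => /(le_trans (ler_norm _)); rewrite lerBlDl => /le_trans; apply.
  apply: lerD => //.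
  (* [N * h i] is at least 1 where [f] is at least [i.+1 / N], so as a constant sequence it covers
     that level set and bounds its [rho] by [N * I (h i)]. *)
  pose h (i : nat) (x : T) : R := Num.min N^-1 (Num.max 0 (f x - i%:R / N)).
  have ch i : continuous (h i).
    apply: continuous_fun_min; first exact: continuous_cst.
    apply: continuous_fun_max; first exact: continuous_cst.
    by apply: continuous_fun_sub => //; exact: continuous_cst.
  have -> : I f = \sum_(i < n.+1) I (h i).
    rewrite -I_sum//; apply/eqP; rewrite eq_le; apply/andP.
    have hf x : K x -> f x = \sum_(i < n.+1) h i x.
      move=> /f01/andP[fx0 fx1]; rewrite layer_sum// divff ?gt_eqF//.
      by rewrite min_r.
    by split; apply: I_le => //; try exact: continuous_fun_sum; move=> x /hf ->.
  rewrite ler_pdivrMl// mulr_sumr; apply: ler_sum => i _.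
  rewrite setTI PE/=; apply: rho_le.
  exists (fun _ x => N * h i x).
    split.
    - by move=> _; apply: continuous_fun_mul => //; exact: continuous_cst.
    - move=> _ x; rewrite mulr_ge0 ?(ltW N0)// le_min invr_ge0 (ltW N0).
      by rewrite le_max lexx.
    - by [].
    - move=> x Kx; rewrite /= evE// => fx; exists 0%N.
      rewrite -(mulfV (lt0r_neq0 N0)) ler_pM2l// le_min lexx le_max.
      by apply/orP; right; move: fx; rewrite -/N -natr1 mulrDl mul1r lerBrDl.
  move=> _; have e1 : N * I (h i) = I (fun x => N * h i x).
    rewrite -[LHS]addr0 -[X in _ + X](mul0r (I (h i))) -I_linear//.
    by congr I; apply/funext => y; rewrite mul0r addr0.
  by rewrite -e1.
(* [P] and [I] both have total mass 1, so the inequality for [1 - f] is the reverse inequality for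
   [f]. *)
have unit_eq (f : T -> R) : continuous f -> (forall x, K x -> 0 <= f x <= 1) ->
    \int[P]_u f (ev u) = I f.
  move=> cf f01; apply/eqP; rewrite eq_le unit_le//=.
  have c1 := @continuous_cst R T 1.
  have := unit_le (fun x => 1 - f x) (continuous_fun_sub c1 cf).
  have -> : I (fun x => 1 - f x) = 1 - I f.
    rewrite -[in RHS]I1 -[X in X - _]mul1r -mulN1r -I_linear//.
    by congr I; apply/funext => x; rewrite mul1r mulN1r.
  rewrite RintegralB//; last 2 first.
  - exact: finite_measure_integrable_cst.
  - apply: unit_integrable; [exact: measurableT|exact: mev|by move=> u _; exact: f01].
  rewrite Rintegral_cst// fPT mulr1 lerD2l lerN2; apply => x /f01/andP[? ?].
  by apply/andP; split; lra.
exists _, U, P, ev; split => // f cf.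
have [M Kf] : exists n, K `<=` [set x | 0 < n%:R - `|f x|].
  apply: compact_nondecreasing_cover => // [n|n p np x /=|x Kx].
  - apply: open_lt_preimage; apply: continuous_fun_sub; first exact: continuous_cst.
    by move=> x; apply: cvg_norm; exact: cf.
  - by rewrite !subr_gt0 => /lt_le_trans; apply; rewrite ler_nat.
  - by exists (Num.truncn `|f x|).+1 => //=; rewrite subr_gt0 truncnS_gt.
have M0 : 0 < M%:R :> R.
  by have := Kf _ Kk0 => /=; rewrite subr_gt0; apply: le_lt_trans.
pose b : R := (2 * M%:R)^-1.
have b0 : 0 < b by rewrite invr_gt0 mulr_gt0.
have c1 := @continuous_cst R T 1.
have cg : continuous (fun x => b * f x + 2^-1 * 1).
  by apply: continuous_fun_add; apply: continuous_fun_mul => //; exact: continuous_cst.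
have := unit_eq _ cg; rewrite (@I_linear f (fun=> 1))// I1.
have fM u : [set: U] u -> `|f (ev u)| <= M%:R.
  by move=> _; have := Kf _ (evK u) => /=; rewrite subr_gt0 => /ltW.
have intf : P.-integrable setT (EFin \o (f \o ev)).
  exact: (@bounded_integrable _ _ _ P setT measurableT (f \o ev) M%:R (mev f cf) fM).
rewrite RintegralD//; last 2 first.
- exact: (integrableZl measurableT b intf).
- exact: finite_measure_integrable_cst.
rewrite RintegralZl// Rintegral_cst// fPT !mulr1 => h.
have {}h := h _; apply: (mulfI (lt0r_neq0 b0)); apply: (addIr 2^-1); apply: h => x.
move=> /Kf /=; rewrite subr_gt0 ltr_norml => /andP[h1 h2].
have bM : b * M%:R = 2^-1 by rewrite /b; field; rewrite gt_eqF.
by apply/andP; split; nra.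
Qed.
End riesz.

(** * Baire sets and signed measures *)

Section baire_sets.
Context (R : realType) (X : topologicalType) (x0 : X).
Local Notation bs := (baire_space R x0).
Implicit Types (f g : X -> R) (A E : set X).

Lemma baire_measurableE A : measurable (A : set bs) = baire R A.
Proof. by []. Qed.

Lemma continuous_baire f : continuous f -> measurable_fun setT (f : bs -> R).
Proof.
move=> cf _ B mB; rewrite setTI; apply: sub_sigma_algebra.
by exists f => //; exists B => //; rewrite setTI.
Qed.

Definition cozero_sets : set (set X) :=
  [set A | exists2 f : X -> R, continuous f & A = [set x | 0 < f x]].

(** Open rays generate the Borel sets of the line, and [f - c] is continuous with [f]. The gain over
    the original generator is stability under intersections, which makes Dynkin induction
    available. *)
Lemma baire_cozeroE :
  @measurable _ bs = <<s (cozero_sets : set (set (pointed_at x0))) >>.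
Proof.
pose G : set (set (pointed_at x0)) := cozero_sets.
apply/seteqP; split.
  apply: smallest_sub; first exact: smallest_sigma_algebra.
  move=> _ [f cf [B mB <-]].
  have mf : measurable_fun setT (f : g_sigma_algebraType G -> R).
    apply: measurable_fun_rays => // c; rewrite setTI; apply: sub_sigma_algebra.
    exists (fun x => f x - c).
      by apply: continuous_fun_sub => //; exact: continuous_cst.
    by apply/funext => x /=; rewrite subr_gt0.
  exact: (mf measurableT B mB).
apply: smallest_sub; first exact: (@smallest_sigma_algebra _ setT).
move=> _ [f cf ->].
rewrite -[X in measurable X]setTI (_ : [set x | _] = f @^-1` `]0, +oo[).
  by apply: continuous_baire => //; exact: measurable_itv.
by apply/seteqP; split => x /=; rewrite in_itv/= andbT.
Qed.

Lemma cozero_setI : setI_closed cozero_sets.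
Proof.
move=> _ _ [f cf ->] [g cg ->]; exists (fun x => Num.min (f x) (g x)).
  exact: continuous_fun_min.
by apply/seteqP; split => x /=; rewrite lt_min => /andP.
Qed.

Lemma cozero_baire A : cozero_sets A -> baire R A.
Proof.
move=> GA; rewrite -baire_measurableE baire_cozeroE.
by apply: sub_sigma_algebra.
Qed.

Lemma baire_induction (P : set (set X)) : P setT -> cozero_sets `<=` P ->
  (forall A, baire R A -> P A -> P (~` A)) ->
  (forall F : nat -> set X, (forall n, baire R (F n)) -> trivIset setT F ->
    (forall n, P (F n)) -> P (\bigcup_n F n)) ->
  forall A, baire R A -> P A.
Proof.
move=> PT PG PC PU A mA.
apply: (@dynkin_induction _ bs _ P baire_cozeroE cozero_setI PT PG PC PU A).
by rewrite -baire_cozeroE.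
Qed.

Definition cozero_approx f (n : nat) : X -> R :=
  fun x => Num.min 1 (n%:R * Num.max 0 (f x)).

Lemma cozero_approx_continuous f n : continuous f -> continuous (cozero_approx f n).
Proof.
move=> cf; apply: continuous_fun_min; first exact: continuous_cst.
apply: continuous_fun_mul; first exact: continuous_cst.
by apply: continuous_fun_max => //; exact: continuous_cst.
Qed.

Lemma cozero_approx01 f n x : 0 <= cozero_approx f n x <= 1.
Proof.
by rewrite /cozero_approx le_min ler01 ge_min lexx/= mulr_ge0// le_max lexx.
Qed.

Lemma cozero_approx_cvg f x :
  cozero_approx f n x @[n --> \oo] --> (\1_[set x | 0 < f x] x : R).
Proof.
have [fx|fx] := ltP 0 (f x).
  rewrite indicE mem_set//; apply: cvg_near_cst.
  near=> n; rewrite /cozero_approx min_l// max_r ?(ltW fx)//.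
  rewrite -ler_pdivrMr// div1r; near: n; exact: nbhs_infty_ger.
rewrite indicE memNset ?/= -?leNgt//; last by apply/negP; rewrite -leNgt.
rewrite (_ : (fun n => _) = fun=> 0); first exact: cvg_cst.
by apply/funext => n; rewrite /cozero_approx max_l// mulr0 min_r.
Unshelve. all: by end_near.
Qed.

Lemma indic01 E x : 0 <= (\1_E x : R) <= 1.
Proof. by rewrite indicE; case: (_ \in _); rewrite ?lexx ?ler01. Qed.

Variable m : {finite_measure set bs -> \bar R}.

(** Dynkin induction on [E]: cozero sets by dominated convergence, complements by [1 - f], disjoint
    unions by approximating a finite partial union with a maximum of approximants. No separation
    property of [X] enters. *)
Lemma continuous_dense_L1 E : baire R E -> forall e : R, 0 < e ->
  exists f, [/\ continuous f, forall x, 0 <= f x <= 1 &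
    \int[m]_x `|f x - \1_E x| < e].
Proof.
have uf f : continuous f -> (forall x, 0 <= f x <= 1) ->
  (unit_measurable bs R f) by move=> cf f01; split => //; exact: continuous_baire.
have ui A : baire R A -> unit_measurable bs R \1_A.
  by move=> mA; split => [|x]; [exact: measurable_indic|exact: indic01].
move: E; apply: baire_induction => [e e0|_ [f cf ->] e e0|A mA PA e e0|F mF tF PF e e0].
- exists (fun=> 1); split; [exact: continuous_cst|by move=> _; rewrite ler01 lexx|].
  under eq_Rintegral do rewrite indicE in_setT subrr normr0.
  by rewrite Rintegral_cst// mul0r.
- have mA : baire R [set x | 0 < f x] by apply: cozero_baire; exists f.
  have : (fun n => \int[m]_x `|cozero_approx f n x - \1_[set x | 0 < f x] x|) @ \oo
      --> \int[m]_(x in setT) 0.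
    apply: (@Rintegral_bounded_cvg _ _ _ m setT measurableT _ _ 1) => [n|n x _|x _].
    + apply: measurableT_comp => //; apply: measurable_funB; last exact: measurable_indic.
      by apply: continuous_baire; exact: cozero_approx_continuous.
    + rewrite normr_id ler_norml.
      have /andP[? ?] := cozero_approx01 f n x.
      have /andP[? ?] := indic01 [set x | 0 < f x] x.
      by apply/andP; split; lra.
    + set c : R := \1_[set x | 0 < f x] x.
      have h : (fun n => cozero_approx f n x - c) @ \oo --> c - c.
        by apply: cvgB; [exact: cozero_approx_cvg|exact: cvg_cst].
      by rewrite subrr in h; rewrite -(@normr0 _ R); apply: cvg_norm; exact: h.
  rewrite Rintegral_cst// mul0r => /cvgrPdist_lt/(_ e e0)[n _ /(_ n (leqnn n))].
  rewrite /= sub0r normrN => h; exists (cozero_approx f n); split.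
  + exact: cozero_approx_continuous.
  + exact: cozero_approx01.
  + exact: le_lt_trans (ler_norm _) h.
- have [f [cf f01 fe]] := PA e e0; exists (fun x => 1 - f x); split.
  + by apply: continuous_fun_sub => //; exact: continuous_cst.
  + by move=> x; have /andP[? ?] := f01 x; apply/andP; split; lra.
  + under eq_Rintegral.
      move=> x _; rewrite (_ : `|_| = `|f x - \1_A x|); first over.
      rewrite -normrN; congr Num.norm.
      by rewrite /= !indicE in_setC; case: (_ \in _) => /=; ring.
    exact: fe.
- have mU n : baire R (\big[setU/set0]_(i < n) F i).
    by apply: (@bigsetU_measurable _ bs) => i _; exact: mF.
  have mUF : baire R (\bigcup_n F n) by apply: (@bigcupT_measurable _ bs).
  have FU n : forall e : R, 0 < e -> exists f, [/\ continuous f,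
      forall x, 0 <= f x <= 1 & \int[m]_x `|f x - \1_(\big[setU/set0]_(i < n) F i) x| < e].
    elim: n => [|n IH] d d0.
      exists (fun=> 0); split; [exact: continuous_cst|by move=> _; rewrite lexx ler01|].
      under eq_Rintegral do rewrite big_ord0 indicE in_set0 subrr normr0.
      by rewrite Rintegral_cst// mul0r.
    have d2 : 0 < d / 2 by rewrite divr_gt0.
    have [f [cf f01 fd]] := IH _ d2; have [g [cg g01 gd]] := PF n _ d2.
    have h01 x : 0 <= Num.max (f x) (g x) <= 1.
      have /andP[? ?] := f01 x; have /andP[? ?] := g01 x.
      by rewrite le_max ge_max; apply/andP; split; apply/orP + apply/andP; auto.
    exists (fun x => Num.max (f x) (g x)); split => //; first exact: continuous_fun_max.
    have I1 := unit_normB_integrable m (uf _ cf f01) (ui _ (mU n)).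
    have I2 := unit_normB_integrable m (uf _ cg g01) (ui _ (mF n)).
    apply: (@le_lt_trans _ _ (\int[m]_x (`|f x - \1_(\big[setU/set0]_(i < n) F i) x| +
        `|g x - \1_(F n) x|))); last by rewrite RintegralD//; lra.
    apply: le_Rintegral => //.
    + by apply: unit_normB_integrable; [apply: uf => //; exact: continuous_fun_max|exact: ui].
    + exact: (integrableD measurableT I1 I2).
    + move=> x _; rewrite big_ord_recr/= !indicE in_setU.
      have -> (b c : bool) : (b || c)%:R = Num.max b%:R c%:R :> R.
        by case: b; case: c; rewrite ?maxxx ?(max_l ler01) ?(max_r ler01).
      exact: ler_dist_max.
  have cU : (fun n => \int[m]_x `|\1_(\big[setU/set0]_(i < n) F i) x - \1_(\bigcup_n F n) x|)
      @ \oo --> \int[m]_(x in setT) (0 : R).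
    apply: (@Rintegral_bounded_cvg _ _ _ m setT measurableT _ _ 1) => [n|n x _|x _].
    + apply: measurableT_comp => //; apply: measurable_funB; apply: measurable_indic.
        exact: mU.
      exact: mUF.
    + rewrite normr_id ler_norml.
      have /andP[? ?] := indic01 (\big[setU/set0]_(i < n) F i) x.
      have /andP[? ?] := indic01 (\bigcup_n F n) x.
      by apply/andP; split; lra.
    + apply: cvg_near_cst; have [[k _ Fkx]|nF] := pselect ((\bigcup_n F n) x).
        near=> n; rewrite !indicE !mem_set ?subrr ?normr0//; first by exists k.
        rewrite -bigcup_mkord; exists k => //=; near: n; exact: nbhs_infty_gt.
      apply: nearW => n; rewrite !indicE !memNset ?subrr ?normr0//.
      by rewrite -bigcup_mkord => -[k _ Fkx]; apply: nF; exists k.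
  have e2 : 0 < e / 2 by rewrite divr_gt0.
  move: cU; rewrite Rintegral_cst// mul0r => /cvgrPdist_lt/(_ _ e2)[n _ /(_ n (leqnn n))].
  rewrite /= sub0r normrN => h; have [f [cf f01 fe]] := FU n _ e2.
  exists f; split => //.
  have I1 := unit_normB_integrable m (uf _ cf f01) (ui _ (mU n)).
  have I2 := unit_normB_integrable m (ui _ (mU n)) (ui _ mUF).
  apply: (@le_lt_trans _ _ (\int[m]_x (`|f x - \1_(\big[setU/set0]_(i < n) F i) x| +
      `|\1_(\big[setU/set0]_(i < n) F i) x - \1_(\bigcup_n F n) x|))).
    apply: le_Rintegral => //.
    + by apply: unit_normB_integrable; [exact: uf|exact: ui].
    + exact: (integrableD measurableT I1 I2).
    + by move=> x _; exact: ler_distD.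
  by rewrite RintegralD//; have := ler_norm (\int[m]_x `|\1_(\big[setU/set0]_(i < n) F i) x - \1_(\bigcup_n F n) x|); lra.
Unshelve. all: by end_near.
Qed.

End baire_sets.

Lemma eq0_of_le_inv (R : realType) (x C : R) :
  (forall n, `|x| <= n.+1%:R^-1 * C) -> x = 0.
Proof.
move=> h; apply/eqP; rewrite -normr_eq0 eq_le normr_ge0 andbT.
apply/ler_addgt0Pr => e e0; rewrite add0r.
pose n := Num.truncn (`|C| / e).
rewrite (le_trans (h n))// mulrC ler_pdivrMr ?ltr0n//.
rewrite (le_trans (ler_norm _))// mulrC -ler_pdivrMr// ltW//.
exact: truncnS_gt.
Qed.

Section signed_measure_theory.
Context (R : realType) (X : topologicalType) (x0 : X).
Local Notation bs := (baire_space R x0).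
Implicit Types (nu : signed_measure R X) (f g : X -> R) (A E : set X).

Definition pospart nu : {finite_measure set bs -> \bar R} := pos_part_at x0 nu.
Definition negpart nu : {finite_measure set bs -> \bar R} := neg_part_at x0 nu.

Lemma signed_measure_jordan nu A : baire R A ->
  nu A = fine (pospart nu A) - fine (negpart nu A).
Proof.
move=> mA; apply: EFin_inj.
have := jordan_decomp (projT2 (hahn_at x0 nu)) (mA : measurable (A : set bs)).
rewrite /cadd/= cscaleN1 => e.
rewrite EFinB !fineK ?fin_num_measure//.
Qed.

Lemma signed_measure_lincomb a b nu nu' A :
  (a *: nu + b *: nu') A = a * nu A + b * nu' A.
Proof. by []. Qed.

Definition tv nu : R := fine (pospart nu setT) + fine (negpart nu setT).

(* [sint nu] and [vint nu] are integration against [nu] and [|nu|]. *)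
Definition sint nu f : R := \int[pospart nu]_x f x - \int[negpart nu]_x f x.

Definition vint nu f : R := \int[pospart nu]_x f x + \int[negpart nu]_x f x.

Definition bounded_baire f :=
  measurable_fun setT (f : bs -> R) /\ exists M, forall x, `|f x| <= M.

Lemma bounded_baire_integrable f (m : {finite_measure set bs -> \bar R}) :
  bounded_baire f -> m.-integrable setT (EFin \o f).
Proof. by move=> [mf [M fM]]; apply: (@bounded_integrable _ _ _ _ _ _ _ M). Qed.

Lemma unit_bounded_baire f : unit_measurable bs R f -> bounded_baire f.
Proof.
move=> [mf f01]; split => //; exists 1 => x; have /andP[? ?] := f01 x.
by rewrite ger0_norm.
Qed.

Lemma bounded_baire_lin a b f g : bounded_baire f -> bounded_baire g ->
  bounded_baire (fun x => a * f x + b * g x).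
Proof.
move=> [mf [M fM]] [mg [L gL]]; split.
  by apply: measurable_funD; apply: measurable_funM.
exists (`|a| * M + `|b| * L) => x; rewrite (le_trans (ler_normD _ _))//.
by rewrite !normrM lerD// ler_wpM2l.
Qed.

Lemma bounded_baireM f g : bounded_baire f -> bounded_baire g ->
  bounded_baire (fun x => f x * g x).
Proof.
move=> [mf [M fM]] [mg [L gL]]; split; first exact: measurable_funM.
by exists (M * L) => x; rewrite normrM ler_pM.
Qed.

Lemma bounded_baire_cst a : bounded_baire (fun=> a).
Proof. by split => //; exists `|a|. Qed.

Lemma Rintegral_lin (m : {finite_measure set bs -> \bar R}) a b f g :
  bounded_baire f -> bounded_baire g ->
  \int[m]_x (a * f x + b * g x) = a * \int[m]_x f x + b * \int[m]_x g x.
Proof.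
move=> /(bounded_baire_integrable m) bf /(bounded_baire_integrable m) bg.
have I1 := integrableZl measurableT a bf; have I2 := integrableZl measurableT b bg.
by rewrite RintegralD// !RintegralZl.
Qed.

Lemma sint_lin nu a b f g : bounded_baire f -> bounded_baire g ->
  sint nu (fun x => a * f x + b * g x) = a * sint nu f + b * sint nu g.
Proof. by move=> bf bg; rewrite /sint !Rintegral_lin//; ring. Qed.

Lemma vint_lin nu a b f g : bounded_baire f -> bounded_baire g ->
  vint nu (fun x => a * f x + b * g x) = a * vint nu f + b * vint nu g.
Proof. by move=> bf bg; rewrite /vint !Rintegral_lin//; ring. Qed.

Lemma le_vint nu f g : bounded_baire f -> bounded_baire g ->
  (forall x, f x <= g x) -> vint nu f <= vint nu g.
Proof.
by move=> bf bg fg; apply: lerD; apply: le_Rintegral => //;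
  exact: bounded_baire_integrable.
Qed.

Lemma vint_ge0 nu f : (forall x, 0 <= f x) -> 0 <= vint nu f.
Proof. by move=> f0; apply: addr_ge0; apply: Rintegral_ge0. Qed.

Lemma sint_cst nu a : sint nu (fun=> a) = a * nu setT.
Proof.
by rewrite /sint !Rintegral_cst// signed_measure_jordan ?mulrBr//; exact: (@measurableT _ bs).
Qed.

Lemma vint1 nu : vint nu (fun=> 1) = tv nu.
Proof. by rewrite /vint !Rintegral_cst// !mul1r. Qed.

Lemma signed_measure_le_tv nu A : baire R A -> `|nu A| <= tv nu.
Proof.
move=> mA; rewrite signed_measure_jordan//.
have h (m : {finite_measure set bs -> \bar R}) : 0 <= fine (m A) <= fine (m setT).
  apply/andP; split; first exact: fine_ge0.
  apply: fine_le; rewrite ?fin_num_measure//.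
  by apply: le_measure => //; exact: mem_set.
have /andP[? ?] := h (pospart nu); have /andP[? ?] := h (negpart nu).
by rewrite /tv ler_norml; apply/andP; split; lra.
Qed.

(** The approximating sum of [layer_cake], evaluated by [nu] itself. It is linear in [nu], whereas
    [sint] passes through the Jordan parts, which do not depend linearly on [nu]. *)
Definition layer_sum f n (nu : set X -> R) : R :=
  n.+1%:R^-1 * \sum_(i < n.+1) nu [set x | i.+1%:R / n.+1%:R <= f x].

Lemma layer_baire f (c : R) : measurable_fun setT (f : bs -> R) ->
  baire R [set x | c <= f x].
Proof.
move=> mf; rewrite -(baire_measurableE R x0) -[X in measurable X]setTI.
rewrite (_ : [set x | c <= f x] = f @^-1` `[c, +oo[).
  by apply: mf => //; exact: measurable_itv.
by apply/seteqP; split => x /=; rewrite in_itv/= andbT.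
Qed.

Lemma sint_layer nu f n : unit_measurable bs R f ->
  `|sint nu f - layer_sum f n nu| <= n.+1%:R^-1 * tv nu.
Proof.
move=> [mf f01].
have Lp := @layer_cake _ _ _ (pospart nu) setT measurableT f n mf (fun x _ => f01 x).
have Ln := @layer_cake _ _ _ (negpart nu) setT measurableT f n mf (fun x _ => f01 x).
have -> : layer_sum f n nu = n.+1%:R^-1 * \sum_(i < n.+1)
     fine (pospart nu (setT `&` [set x | i.+1%:R / n.+1%:R <= f x])) -
   n.+1%:R^-1 * \sum_(i < n.+1)
     fine (negpart nu (setT `&` [set x | i.+1%:R / n.+1%:R <= f x])).
  rewrite -mulrBr -sumrB; congr *%R; apply: eq_bigr => i _.
  by rewrite !setTI signed_measure_jordan//; exact: layer_baire.
have tri (P Q S1 S2 c a b : R) : `|P - S1| <= c * a -> `|Q - S2| <= c * b ->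
    `|(P - Q) - (S1 - S2)| <= c * (a + b).
  rewrite !ler_norml => /andP[? ?] /andP[? ?].
  by apply/andP; split; lra.
exact: tri Lp Ln.
Qed.

Lemma layer_sum_lin f n nu nu' a b :
  layer_sum f n (a *: nu + b *: nu') =
  a * layer_sum f n nu + b * layer_sum f n nu'.
Proof.
rewrite /layer_sum (mulrCA a) (mulrCA b) -mulrDr; congr (_ * _).
by rewrite !mulr_sumr -big_split/=; apply: eq_bigr => i _.
Qed.

(** All three integrals are within a multiple of [1 / n.+1] of their layer sums, for which the
    identity is exact. *)
Lemma sint_unit_lincomb nu nu' a b f : unit_measurable bs R f ->
  sint (a *: nu + b *: nu') f = a * sint nu f + b * sint nu' f.
Proof.
move=> uf; apply/eqP; rewrite -subr_eq0; apply/eqP.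
apply: (@eq0_of_le_inv _ _ (tv (a *: nu + b *: nu') + `|a| * tv nu + `|b| * tv nu')) => n.
have h1 := sint_layer (a *: nu + b *: nu') n uf.
have h2 := sint_layer nu n uf; have h3 := sint_layer nu' n uf.
rewrite layer_sum_lin in h1.
set x := sint _ _ in h1 *; set y := sint _ _ in h2 *; set z := sint _ _ in h3 *.
set y' := layer_sum _ _ _ in h1 h2; set z' := layer_sum _ _ _ in h1 h3.
have -> : x - (a * y + b * z) =
  (x - (a * y' + b * z')) - (a * (y - y') + b * (z - z')) by ring.
apply: (le_trans (ler_normB _ _)); rewrite -[tv _ + _ + _]addrA [leRHS]mulrDr.
apply: lerD => //; apply: (le_trans (ler_normD _ _)).
rewrite [leRHS]mulrDr !normrM.
by apply: lerD; rewrite [leRHS]mulrCA; apply: ler_wpM2l.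
Qed.

Lemma unit_rescale f M : 0 < M -> (forall x, `|f x| <= M) ->
  measurable_fun setT (f : bs -> R) ->
  unit_measurable bs R (fun x => (2 * M)^-1 * f x + 2^-1 * 1).
Proof.
move=> M0 fM mf; split.
  by apply: measurable_funD => //; apply: measurable_funM.
move=> x; have := fM x; rewrite ler_norml => /andP[h1 h2].
have b0 : 0 < (2 * M)^-1 by rewrite invr_gt0 mulr_gt0.
have bM : (2 * M)^-1 * M = 2^-1 by field; rewrite gt_eqF.
by apply/andP; split; nra.
Qed.

(** A bounded function is an affine image of one with values in [0, 1], by [unit_rescale]. *)
Lemma bounded_baire_ind (P : (X -> R) -> Prop) :
  (forall f, unit_measurable bs R f -> P f) ->
  (forall f a b, bounded_baire f -> P f -> P (fun x => a * f x + b * 1)) ->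
  forall f, bounded_baire f -> P f.
Proof.
move=> Pu Pa f [mf [L fL]].
pose M := `|L| + 1.
have M0 : 0 < M by rewrite ltr_wpDl.
have fM x : `|f x| <= M.
  by rewrite (le_trans (fL x))// (le_trans (ler_norm _))// lerDl.
have ug := unit_rescale M0 fM mf.
have := Pa _ (2 * M) (- M) (unit_bounded_baire ug) (Pu _ ug).
rewrite (_ : (fun x => _) = f)//; apply/funext => x.
by field; rewrite gt_eqF.
Qed.

Lemma sint_lincomb nu nu' a b f : bounded_baire f ->
  sint (a *: nu + b *: nu') f = a * sint nu f + b * sint nu' f.
Proof.
move: f; apply: bounded_baire_ind => [f|f c d bf fE]; first exact: sint_unit_lincomb.
have b1 := bounded_baire_cst 1.
rewrite !(@sint_lin _ c d f (fun=> 1))// fE !sint_cst signed_measure_lincomb; ring.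
Qed.

(** Up to sign, the Jordan parts are [nu] restricted to the two Hahn sets, so their values at [A]
    are values of [nu] at Baire subsets of [A]. *)
Lemma null_parts nu A : baire R A ->
  (forall E, baire R E -> E `<=` A -> nu E = 0) ->
  pospart nu A = 0%E /\ negpart nu A = 0%E.
Proof.
move=> mA nuA; have [[mP _] [mN _] _ _] := projT2 (hahn_at x0 nu).
have mA' : (A : set bs) \in measurable by exact: mem_set.
split.
  rewrite /pospart/= /pos_part_at jordan_posE cjordan_posE /crestr0 mA' /crestr/=.
  by rewrite /charge_at nuA//; exact: (@measurableI _ bs).
rewrite /negpart/= /neg_part_at jordan_negE cjordan_negE /crestr0 mA' /crestr/=.
by rewrite /charge_at nuA ?oppr0//; exact: (@measurableI _ bs).
Qed.

Lemma parts_null nu A E : baire R A -> baire R E -> E `<=` A ->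
  pospart nu A = 0%E -> negpart nu A = 0%E -> nu E = 0.
Proof.
move=> mA mE EA pA nA; rewrite signed_measure_jordan//.
have h (m : {finite_measure set bs -> \bar R}) : m A = 0%E -> m E = 0%E.
  move=> mA0; apply/eqP; rewrite eq_le measure_ge0 andbT -mA0.
  by apply: le_measure => //; exact: mem_set.
by rewrite !h// subrr.
Qed.

(* Against the positive and the negative part of [nu] respectively, [1 - h] and
   [1 + h] have integrals adding up to at most [e]. *)
Lemma vint_norming nu h g e : bounded_baire h -> (forall x, -1 <= h x <= 1) ->
  tv nu <= sint nu h + e -> unit_measurable bs R g ->
  sint nu (fun x => h x * g x) <= vint nu g <= sint nu (fun x => h x * g x) + e.
Proof.
move=> bh h11 he ug; have bg := unit_bounded_baire ug.
have b1 := bounded_baire_cst 1.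
have bhg := bounded_baireM bh bg.
have g01 x : 0 <= g x <= 1 := ug.2 x.
have bP := bounded_baire_lin 1 (- 1) b1 bh.
have bN := bounded_baire_lin 1 1 b1 bh.
have bP' := bounded_baire_lin 1 (- 1) bg bhg.
have bN' := bounded_baire_lin 1 1 bg bhg.
have pos (m : {finite_measure set bs -> \bar R}) :
    0 <= \int[m]_x (1 * g x + (- 1) * (h x * g x)) <= \int[m]_x (1 * 1 + (- 1) * h x).
  apply/andP; split.
    by apply: Rintegral_ge0 => x _; have /andP[? ?] := h11 x; have /andP[? ?] := g01 x; nra.
  apply: le_Rintegral => //; [exact: bounded_baire_integrable|exact: bounded_baire_integrable|].
  by move=> x _; have /andP[? ?] := h11 x; have /andP[? ?] := g01 x; nra.
have neg (m : {finite_measure set bs -> \bar R}) :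
    0 <= \int[m]_x (1 * g x + 1 * (h x * g x)) <= \int[m]_x (1 * 1 + 1 * h x).
  apply/andP; split.
    by apply: Rintegral_ge0 => x _; have /andP[? ?] := h11 x; have /andP[? ?] := g01 x; nra.
  apply: le_Rintegral => //; [exact: bounded_baire_integrable|exact: bounded_baire_integrable|].
  by move=> x _; have /andP[? ?] := h11 x; have /andP[? ?] := g01 x; nra.
have := pos (pospart nu); have := neg (negpart nu).
rewrite !Rintegral_lin//.
move: he; rewrite -vint1 /vint /sint.
set a := \int[_]_x _; set b := \int[_]_x _; set c := \int[_]_x _.
set d := \int[_]_x _; set i := \int[_]_x _; set j := \int[_]_x _.
set k := \int[_]_x _; set l := \int[_]_x _ => *.
by apply/andP; split; lra.
Qed.

Hypothesis x0E : some_point X = Some x0.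

Lemma smintegralE nu f : smintegral nu f = sint nu f.
Proof. by rewrite /smintegral x0E. Qed.

Lemma smvariationE nu : smvariation nu setT = (tv nu)%:E.
Proof.
by rewrite /smvariation x0E /variation_at /tv EFinD !fineK// fin_num_measure.
Qed.

End signed_measure_theory.

(** * Weak* limits and barycentres *)

Section weak_star.
Context (R : realType) (X : topologicalType).
Local Notation M := (signed_measure R X).

Lemma smintegral_continuous (f : X -> R) : continuous f -> bounded_fun f ->
  continuous (fun nu : M => smintegral nu f).
Proof.
move=> cf bf; pose i : bounded_continuous R X := exist _ f (conj cf bf).
move=> nu A /=.
have /cvg_sup /(_ i) h : nbhs nu --> nu by exact: cvg_id.
move=> /(@initial_continuous _ _ (fun nu : M => smintegral nu (sval i)) nu A).
exact: h.
Qed.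

Lemma cvg_weak_star (F : set_system M) (nu : M) : Filter F ->
  (forall f : X -> R, continuous f -> bounded_fun f ->
    (fun m : M => smintegral m f) @ F --> smintegral nu f) ->
  F --> nu.
Proof.
move=> FF h; apply/cvg_sup => -[f [cf bf]] U [? /= [[W oW <-]]] Wn sWU.
rewrite nbhs_filterE; apply: filterS sWU _.
by apply: (h f cf bf); exact: open_nbhs_nbhs.
Qed.
End weak_star.

(** * Convex combinations and the minimax functional *)

Section convex_combinations.
Context (R : realType) (T : lmodType R) (A : set T).

(* Convex combinations of points of [A], paired with the evaluation at them
   regarded as a functional on all functions [T -> R]. *)
Inductive conv_eval : T -> ((T -> R) -> R) -> Prop :=
| conv_eval_point m : A m -> conv_eval m (fun g => g m)
| conv_eval_comb m m' J J' t : 0 <= t <= 1 -> conv_eval m J -> conv_eval m' J' ->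
    conv_eval (t *: m + (1 - t) *: m') (fun g => t * J g + (1 - t) * J' g).

Lemma conv_eval_linear m J : conv_eval m J -> forall (f g : T -> R) a b,
  J (fun x => a * f x + b * g x) = a * J f + b * J g.
Proof.
by elim=> [//|m1 m2 J1 J2 t _ _ IH1 _ IH2] f g a b; rewrite IH1 IH2; ring.
Qed.

Lemma conv_eval_ge m J : conv_eval m J -> forall (g : T -> R) c,
  (forall x, A x -> c <= g x) -> c <= J g.
Proof.
elim=> [x Ax g c h|m1 m2 J1 J2 t /andP[t0 t1] _ IH1 _ IH2 g c h]; first exact: h.
by have := IH1 g c h; have := IH2 g c h; nra.
Qed.

Lemma conv_eval_le m J : conv_eval m J -> forall (g : T -> R) c,
  (forall x, A x -> g x <= c) -> J g <= c.
Proof.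
elim=> [x Ax g c h|m1 m2 J1 J2 t /andP[t0 t1] _ IH1 _ IH2 g c h]; first exact: h.
by have := IH1 g c h; have := IH2 g c h; nra.
Qed.

Lemma conv_eval_cst m J c : conv_eval m J -> J (fun=> c) = c.
Proof. by elim=> [//|m1 m2 J1 J2 t _ _ -> _ ->]; ring. Qed.

Lemma conv_eval_self m J : conv_eval m J -> forall g : T -> R,
  (forall x y a b, g (a *: x + b *: y) = a * g x + b * g y) -> J g = g m.
Proof.
by elim=> [//|m1 m2 J1 J2 t _ _ IH1 _ IH2] g gl; rewrite gl IH1// IH2.
Qed.

Lemma conv_eval_hull m J (C : set T) : conv_eval m J -> @convex_set R T C ->
  A `<=` C -> C m.
Proof.
move=> mJ cC AC; elim: mJ => [x /AC//|m1 m2 J1 J2 t /andP[t0 t1] _ C1 _ C2].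
by apply: set_mem; apply: (cC m1 m2 (Itv01 t0 t1)); exact: mem_set.
Qed.

End convex_combinations.

Lemma ultra_fmap (T U : Type) (f : T -> U) (F : set_system T) :
  UltraFilter F -> UltraFilter (f @ F).
Proof.
move=> UF; have FF : ProperFilter F := ultra_proper.
split; first exact: fmap_proper_filter.
move=> G GG FG; apply/seteqP; split=> [B GB|B /FG//].
have [//|FB] := in_ultra_setVsetC (f @^-1` B) UF.
have /FG GCB : (f @ F) (~` B) by [].
have : G (B `&` ~` B) by exact: filterI.
by rewrite setICr => /filter_not_empty.
Qed.

Section minimax.
Context (R : realType) (T : lmodType R) (top : Topological T).
Local Notation TT := (Topological.Pack top).
Variable (A : set T).
Hypothesis A_compact : compact (A : set TT).
Hypothesis A_neq0 : A !=set0.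
Variable (L : set (T -> R)) (e e' : R).
Hypothesis e'e : e' < e.
Hypothesis L_continuous : forall f, L f -> continuous (f : TT -> R).
Hypothesis L_minimax : forall n (w : nat -> R) (f : nat -> T -> R),
  (forall i, 0 <= w i) -> \sum_(i < n) w i = 1 ->
  (forall i, (i < n)%N -> L (f i)) ->
  exists2 m, A m & e <= \sum_(i < n) w i * f i m.

Let pairT : Type := (T * ((T -> R) -> R))%type.

(** If no convex combination of points of [A] worked, the vectors of values minus [e'] would form a
    convex set to which [convex_alternative] applies. Its weights give a combination of the
    functions that is at most [e' < e] on all of [A], against [L_minimax]. *)
Lemma finite_minimax (s : seq (T -> R)) : (forall f, List.In f s -> L f) ->
  exists2 p : pairT, conv_eval A p.1 p.2 & forall f, List.In f s -> e' <= p.2 f.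
Proof.
move=> sL; have [s0|sn0] := posnP (size s).
  have [m Am] := A_neq0; exists (m, fun g => g m); first exact: conv_eval_point.
  by rewrite (size0nil s0).
apply: contrapT => nP.
pose n := (size s).-1; have sE : size s = n.+1 by rewrite prednK.
pose d : T -> R := fun=> 0.
have nthL i : (i < n.+1)%N -> List.In (nth d s i) s.
  rewrite -sE; elim: (s) i => [//|f t IH] [|i] /=; first by left.
  by rewrite ltnS => /IH; right.
have [||w [w0 w1 wD]] := @convex_alternative R n
  [set y | exists2 p : pairT, conv_eval A p.1 p.2 &
    y = fun i => p.2 (nth d s i) - e'].
- move=> y z t [[m J] mJ ->] [[m' J'] mJ' ->] t01.
  exists ((1 - t) *: m + (1 - (1 - t)) *: m',
    fun g => (1 - t) * J g + (1 - (1 - t)) * J' g) => /=.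
    apply: conv_eval_comb => //; case/andP: t01 => *; apply/andP; split; lra.
  by apply/funext => i; ring.
- move=> y [[m J] mJ ->]; apply: contrapT => h; apply: nP; exists (m, J) => // f.
  have : forall i, (i < n.+1)%N -> e' <= J (nth d s i).
    move=> i ilt; rewrite leNgt; apply/negP => lt; apply: h; exists i => //=.
    by rewrite subr_le0 ltW.
  rewrite -sE /=; elim: (s) => [//|g t IH] h' /= [<-|]; first exact: (h' 0%N).
  by apply: IH => i ilt; exact: (h' i.+1).
have [m Am] := L_minimax w0 w1 (fun i ilt => sL _ (nthL i ilt)).
apply/negP; rewrite -ltNge.
have := wD _ (ex_intro2 _ _ (m, fun g => g m) (conv_eval_point Am) erefl) => /=.
under eq_bigr do rewrite mulrBr.
rewrite sumrB -mulr_suml w1 mul1r subr_le0 => /le_lt_trans; apply.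
exact: e'e.
Qed.

(** The solutions for finite lists form a filter base; [F] is an ultrafilter above it. A continuous
    [g] is bounded on the compact set [A], so its evaluations stay in a compact interval and
    converge along [F]. Keeping [F] besides [I] later identifies the barycentre as a limit of the
    combinations themselves. *)
Lemma minimax_functional : exists (F : set_system pairT) (I : (T -> R) -> R),
  [/\ ProperFilter F, F [set p | conv_eval A p.1 p.2],
      forall g, continuous (g : TT -> R) -> (fun p : pairT => p.2 g) @ F --> I g &
      forall f, L f -> e' <= I f].
Proof.
pose D := [set s : seq (T -> R) | forall f, List.In f s -> L f].
pose B (s : seq (T -> R)) := [set p : pairT | conv_eval A p.1 p.2 /\
  forall f, List.In f s -> e' <= p.2 f].
have FB : ProperFilter (filter_from D B).
  apply: filter_from_proper; last first.
    by move=> s /finite_minimax[p p1 p2]; exists p.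
  apply: filter_from_filter; first by exists [::].
  move=> s t Ds Dt; exists (s ++ t).
    by move=> f /List.in_app_iff[/Ds|/Dt].
  by move=> p [p1 p2]; split; split => // f fs; apply: p2; apply/List.in_app_iff; [left|right].
have [F [UF BF]] := ultraFilterLemma FB.
have FF : ProperFilter F := ultra_proper.
have Fconv : F [set p | conv_eval A p.1 p.2].
  by apply: BF; exists [::] => // p [].
have bnd (g : T -> R) : continuous (g : TT -> R) -> exists C, forall m J,
    conv_eval A m J -> - C <= J g <= C.
  move=> cg; have [n An] : exists n, A `<=` [set m | 0 < n%:R - `|g m|].
    apply: (@compact_nondecreasing_cover TT) => // [n|n p np x /=|x Ax].
    - apply: (@open_lt_preimage R TT (fun m => n%:R - `|g m|)).
      apply: (@continuous_fun_sub R TT (fun=> n%:R)); first exact: continuous_cst.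
      by move=> m; apply: cvg_norm; exact: cg.
    - by rewrite !subr_gt0 => /lt_le_trans; apply; rewrite ler_nat.
    - by exists (Num.truncn `|g x|).+1 => //=; rewrite subr_gt0 truncnS_gt.
  exists n%:R => m J mJ.
  have h x : A x -> - n%:R <= g x <= n%:R.
    by move=> /An /=; rewrite subr_gt0 => /ltW; rewrite ler_norml.
  by apply/andP; split; [apply: conv_eval_ge mJ _ _ _|apply: conv_eval_le mJ _ _ _];
    move=> x /h/andP[].
have cvI (g : T -> R) : continuous (g : TT -> R) ->
    exists l : R, (fun p : pairT => p.2 g) @ F --> l.
  move=> cg; have [C JC] := bnd g cg.
  have UG : UltraFilter ((fun p : pairT => p.2 g) @ F) by exact: ultra_fmap.
  have := @segment_compact R (- C) C; rewrite compact_ultra /= => /(_ _ UG)[|l [_ lP]].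
    suff : F ((fun p : pairT => p.2 g) @^-1` `[- C, C]) by [].
    apply: (@filterS _ F _ _ _ _ Fconv) => -[m J] mJ /=; rewrite in_itv/=; exact: JC mJ.
  by exists l.
have /choice[I IP] : forall g : T -> R, exists l : R, continuous (g : TT -> R) ->
    (fun p : pairT => p.2 g) @ F --> l.
  move=> g; have [/cvI[l ?]|nc] := pselect (continuous (g : TT -> R)); first by exists l.
  by exists 0 => /nc.
exists F, I; split; [exact: FF|exact: Fconv|exact: IP|move=> f Lf].
have cf := IP f (L_continuous Lf).
rewrite -(cvg_lim _ cf)//; apply: limr_ge; first by apply/cvg_ex; eexists; exact: cf.
apply: BF; exists [:: f]; first by move=> g /= [<-|].
by move=> p [_ /(_ f)]; apply; left.
Qed.

End minimax.

(** * Usco maps, the space of sequences and Choquet's scheme *)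

Section usco.
Context (S T : topologicalType).
Implicit Types phi : S -> set T.

Lemma usco_setI phi (D : set T) : usco phi -> closed D ->
  usco (fun s => phi s `&` D).
Proof.
move=> [cphi uphi] cD; split=> [s|G oG]; first exact: compact_closedI.
rewrite (_ : [set s | _] = [set s | phi s `<=` G `|` ~` D]).
  by apply: uphi; apply: openU => //; exact: closed_openC.
apply/seteqP; split=> s /= h x.
  by have [Dx sx|nDx _] := pselect (D x); [left; apply: h|right].
by move=> [/h [//|]].
Qed.

(** The cover is re-indexed by its finite subfamilies: each compact value lies in the union of one
    of them, and upper semicontinuity makes the set of such [s] open, so finitely many subfamilies
    serve all of [K]. *)
Lemma usco_compact_image phi (K : set S) : usco phi -> compact K ->
  compact (\bigcup_(s in K) phi s).
Proof.
move=> [cphi uphi] /compact_coverP cK; apply/compact_coverP => I D f fo fcov.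
pose D' := [set E : {fset I} | {subset E <= D}].
pose f' (E : {fset I}) := [set s | phi s `<=` cover [set` E] f].
have f'o E : D' E -> open (f' E).
  move=> ED; apply: uphi; apply: bigcup_open => i iE.
  by apply: fo; apply: set_mem; exact: ED.
have [s Ks|E' E'D KE'] := cK _ D' f' f'o.
  have /compact_coverP/(_ _ D f fo)[x sx|E ED sE] := cphi s.
    by apply: fcov; exists s.
  by exists E.
exists (\big[fsetU/fset0]_(E <- enum_fset E') E).
  move=> i /bigfcupP[E /andP[EE' _] iE].
  by have /set_mem := E'D _ EE'; apply.
move=> x [s /KE'[E EE' sE] /sE[i iE fx]].
by exists i => //=; apply/bigfcupP; exists E => //; rewrite andbT.
Qed.

End usco.

Section baire_seq.
Implicit Types (s t : baire_seq) (n : nat -> nat).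

Definition bounded_prefix (k : nat) n : set baire_seq :=
  [set s | forall i, (i < k)%N -> (\val (s i) <= n i)%N].

Definition bounded_by n : set baire_seq := [set s | forall i, (\val (s i) <= n i)%N].

Lemma bounded_by_compact n : compact (bounded_by n).
Proof.
apply: (@tychonoff nat (fun=> [set n : nat | (0 < n)%N]) (fun i => [set x | (\val x <= n i)%N])).
move=> i; apply: finite_compact.
apply: (@sub_finite_set _ _ (\val @^-1` `I_(n i).+1)) => [x //|].
by apply: finite_preimage; [move=> x y _ _; exact: val_inj|exact: finite_II].
Qed.

Lemma nbhs_prefix k s : nbhs s [set t | forall i, (i < k)%N -> t i = s i].
Proof.
elim: k => [|k IH]; first by apply: filterS filterT => t _ i.
have h : nbhs s [set t : baire_seq | t k = s k].
  have := @proj_continuous nat (fun=> [set n : nat | (0 < n)%N]) k s [set x | x = s k].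
  apply; apply: (@filterS _ _ _ (\val @^-1` [set \val (s k)])).
    by move=> x /= /val_inj.
  apply: initial_continuous; apply: open_nbhs_nbhs.
  by split => //; exact: discrete_open.
apply: filterS (filterI IH h) => t [tk tk'] i.
by rewrite ltnS leq_eqVlt => /predU1P[->//|/tk].
Qed.

(* Truncating a sequence of [bounded_prefix k n] after [k] terms gives a point
   of the compact set [bounded_by n]. *)
Lemma bounded_by_tube n (U : set baire_seq) : open U -> bounded_by n `<=` U ->
  (forall i, (0 < n i)%N) -> exists k, bounded_prefix k n `<=` U.
Proof.
move=> oU nU n0.
(* The points whose first [j] terms alone force membership in [U]. These sets are open, increase
   with [j] and exhaust [U]. *)
pose G j := [set s : baire_seq | forall t : baire_seq, (forall i, (i < j)%N -> t i = s i) -> U t].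
have [||||j nG] := @compact_nondecreasing_cover _ (bounded_by n) G.
- exact: bounded_by_compact.
- move=> j; rewrite openE => s Gs; rewrite /interior.
  apply: filterS (nbhs_prefix j s) => t ts u ut; apply: Gs => i ij.
  by rewrite ut// ts.
- by move=> j k jk s Gs t ts; apply: Gs => i ij; apply: ts; exact: leq_trans jk.
- move=> s /nU Us; apply: contrapT => nG.
  have /choice[t tP] : forall j, exists t : baire_seq,
      (forall i, (i < j)%N -> t i = s i) /\ ~ U t.
    move=> j; apply: contrapT => h; apply: nG; exists j => // t ts.
    by apply: contrapT => nUt; apply: h; exists t.
  have ts : t @ \oo --> s.
    apply/cvg_sup => i V [? /= [[W oW <-]]] Ws sWV.
    rewrite nbhs_filterE; apply: filterS sWV _.
    exists i.+1 => // j /= ij; have [tj _] := tP j.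
    by rewrite /= tj.
  have : nbhs s U by apply: open_nbhs_nbhs.
  by move=> /ts[m _ /(_ m (leqnn m))]/=; have [_] := tP m.
exists j => s sn.
have one_gt0 : 1%N \in [set n : nat | (0 < n)%N] by apply/mem_set.
(* The tail is filled with the least positive integer, which [0 < n i] keeps within the bound. *)
pose t : baire_seq := fun i => if (i < j)%N then s i else exist _ 1%N one_gt0.
have : bounded_by n t.
  by move=> i; rewrite /t; case: ifPn => [/sn//|_]; exact: n0.
by move=> /nG/(_ s); apply => i ij; rewrite /t ij.
Qed.

End baire_seq.

(** A bad set is the increasing union over [m] of its parts where the next coordinate is at most
    [m], so some part is bad. Repeating this for each coordinate in turn builds [n]. *)
Lemma choquet_scheme (bad : set baire_seq -> Prop) : bad setT ->
  (forall F : nat -> set baire_seq, (forall i j, (i <= j)%N -> F i `<=` F j) ->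
    bad (\bigcup_i F i) -> exists i, bad (F i)) ->
  (forall A B, A `<=` B -> bad A -> bad B) ->
  exists2 n : nat -> nat, (forall i, (0 < n i)%N) & forall k, bad (bounded_prefix k n).
Proof.
move=> badT bad_up bad_mono.
have /choice[h hP] : forall Ak : set baire_seq * nat, exists m : nat,
    (0 < m)%N /\ (bad Ak.1 -> bad (Ak.1 `&` [set s : baire_seq | (\val (s Ak.2) <= m)%N])).
  move=> [A k] /=; have [bA|nbA] := pselect (bad A); last by exists 1%N.
  have [||m bm] := bad_up (fun m => A `&` [set s : baire_seq | (\val (s k) <= m)%N]).
  - by move=> i j ij s [As si]; split => //; exact: leq_trans ij.
  - rewrite (_ : \bigcup_i _ = A)//; apply/seteqP; split=> [s [i _ []]//|s As].
    by exists (\val (s k)) => //; split => //=.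
  (* The successor makes the bound positive; enlarging the part keeps it bad. *)
  exists m.+1; split => // _; apply: bad_mono bm => s [As sm]; split => //=.
  exact: leqW.
pose A := fix A k : set baire_seq :=
  if k is k'.+1 then A k' `&` [set s : baire_seq | (\val (s k') <= h (A k', k'))%N] else setT.
exists (fun k => h (A k, k)) => [i|k]; first by have [] := hP (A i, i).
have : bad (A k) by elim: k => [//|k IH] /=; have [_ /=] := hP (A k, k); exact.
apply: bad_mono; elim: k => [s _ i //|k IH s /= [/IH As sk] i].
by rewrite ltnS leq_eqVlt => /predU1P[->//|]; exact: As.
Qed.

(** * Averages of signed measures *)

Section signed_measure_limits.
Context (R : realType) (X : topologicalType) (x0 : X).
Local Notation bs := (baire_space R x0).
Implicit Types (nu : signed_measure R X).

Lemma sint_bounded_cvg nu (f_ : nat -> X -> R) (f : X -> R) (C : R) :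
  (forall n, measurable_fun setT (f_ n : bs -> R)) ->
  (forall n x, `|f_ n x| <= C) ->
  (forall x, f_ n x @[n --> \oo] --> f x) ->
  sint x0 nu (f_ n) @[n --> \oo] --> sint x0 nu f.
Proof.
by move=> mf fC cf; apply: cvgB; apply: (@Rintegral_bounded_cvg _ _ _ _ _ measurableT _ _ C).
Qed.

Lemma sint_norm_le nu (f : X -> R) : unit_measurable bs R f ->
  `|sint x0 nu f| <= tv x0 nu.
Proof.
move=> [mf f01]; rewrite (le_trans (ler_normB _ _))// /tv.
have h (m : {finite_measure set bs -> \bar R}) : `|\int[m]_x f x| <= fine (m setT).
  rewrite -[leRHS]mul1r; apply: Rintegral_norm_le => // x _.
  by have /andP[? ?] := f01 x; rewrite ger0_norm.
by rewrite lerD.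
Qed.

Lemma sint_indic nu A : baire R A -> sint x0 nu \1_A = nu A.
Proof.
move=> mA; rewrite (signed_measure_jordan x0 nu mA) /sint /Rintegral.
by rewrite !integral_indic//= !setIT.
Qed.

Lemma signed_measureC nu A : baire R A -> nu (~` A) = nu setT - nu A.
Proof.
move=> mA; have mCA : baire R (~` A) by exact: (@measurableC _ bs).
have b1 := bounded_baire_cst x0 1.
have bA : bounded_baire x0 (\1_A : X -> R).
  by apply: unit_bounded_baire; split => [|x]; [exact: measurable_indic|exact: indic01].
rewrite -!sint_indic//; last exact: (@measurableT _ bs).
transitivity (sint x0 nu (fun x => 1 * (fun=> 1) x + (- 1) * \1_A x)).
  congr sint; apply/funext => x; rewrite !indicE in_setC.
  by case: (x \in A) => /=; ring.
rewrite sint_lin// mul1r mulN1r; congr (sint _ _ _ - _).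
by apply/funext => x; rewrite indicE in_setT.
Qed.

Lemma signed_measure_bigsetU nu (F : nat -> set X) n : (forall i, baire R (F i)) ->
  trivIset setT F -> nu (\big[setU/set0]_(i < n) F i) = \sum_(i < n) nu (F i).
Proof.
move=> mF tF; have mU : baire R (\big[setU/set0]_(i < n) F i).
  by apply: (@bigsetU_measurable _ bs) => i _; exact: mF.
have add (m : {finite_measure set bs -> \bar R}) :
    fine (m (\big[setU/set0]_(i < n) F i)) = \sum_(i < n) fine (m (F i)).
  have -> := @measure_semi_additive _ bs _ m F n mF tF mU.
  by rewrite sum_fine// => i _; rewrite fin_num_measure//; exact: mF.
rewrite (signed_measure_jordan x0 nu mU) !add -sumrB.
by apply: eq_bigr => i _; rewrite (signed_measure_jordan x0 nu (mF i)).
Qed.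

End signed_measure_limits.

Section barycentre.
Context (R : realType) (X : topologicalType) (x0 : X).
Local Notation bs := (baire_space R x0).
Local Notation M := (signed_measure R X).
Hypothesis x0E : some_point X = Some x0.
Variables (K : set M) (C : R) (F : set_system (M * ((M -> R) -> R)))
  (I : (M -> R) -> R).
Hypotheses (K_compact : compact K) (K_tv : forall m, K m -> tv x0 m <= C).
Hypotheses (FF : ProperFilter F) (F_conv : F [set p | conv_eval K p.1 p.2]).
Hypothesis F_cvg : forall g : M -> R, continuous g -> (fun p => p.2 g) @ F --> I g.

Let I_eq (g : M -> R) (h : M * ((M -> R) -> R) -> R) (l : R) : continuous g ->
  (forall p, conv_eval K p.1 p.2 -> p.2 g = h p) -> h @ F --> l -> I g = l.
Proof.
move=> cg gh hl; have gl : (fun p => p.2 g) @ F --> l.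
  apply: cvg_trans hl; apply: near_eq_cvg.
  by apply: filterS F_conv => p /= /gh ->.
by rewrite -(cvg_lim _ (F_cvg cg))// -(cvg_lim _ gl).
Qed.

Let I_linear (f g : M -> R) a b : continuous f -> continuous g ->
  I (fun x => a * f x + b * g x) = a * I f + b * I g.
Proof.
move=> cf cg; apply: (@I_eq _ (fun p => a * p.2 f + b * p.2 g)).
- apply: continuous_fun_add; apply: continuous_fun_mul => //; exact: continuous_cst.
- by move=> p /conv_eval_linear ->.
- by apply: cvgD; apply: cvgM; (try exact: cvg_cst); exact: F_cvg.
Qed.

Let I_ge0 (f : M -> R) : continuous f -> (forall x, K x -> 0 <= f x) -> 0 <= I f.
Proof.
move=> cf f0; rewrite -(cvg_lim _ (F_cvg cf))//; apply: limr_ge.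
  by apply/cvg_ex; eexists; exact: F_cvg.
by apply: filterS F_conv => p /= /conv_eval_ge; apply.
Qed.

Let I1 : I (fun=> 1) = 1.
Proof.
apply: (@I_eq _ (fun=> 1)); [exact: continuous_cst| |exact: cvg_cst].
by move=> p /conv_eval_cst ->.
Qed.

Let csm (f : X -> R) : continuous f -> bounded_fun f ->
  continuous (fun nu : M => sint x0 nu f).
Proof.
move=> cf bf; have := smintegral_continuous cf bf.
by under eq_fun do rewrite (smintegralE x0E).
Qed.

Let unit_bounded (f : X -> R) : (forall x, 0 <= f x <= 1) -> bounded_fun f.
Proof.
move=> f01; exists 1; split; first exact: num_real.
move=> y y1 x _ /=; have /andP[? ?] := f01 x.
by rewrite ger0_norm// (@le_trans _ _ 1)// ltW.
Qed.

(** [nu A] is the mean of [m A] under the Riesz measure of [I]. The common bound [C] permits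
    dominated convergence, hence countable additivity, and layer sums pass from sets to integrals.
    Membership in [D] comes from [F]: the convex combinations converge weak* to [nu] along it. *)
Lemma barycentre : exists nu : M,
  (forall f : X -> R, continuous f -> bounded_fun f ->
    sint x0 nu f = I (fun m => sint x0 m f)) /\
  (forall D : set M, closed D -> @convex_set R M D -> K `<=` D -> D nu).
Proof.
have [d [U [P [ev [PT evK ev_meas ev_int]]]]] := riesz K_compact I_linear I_ge0 I1.
have fPT : fine (P setT) = 1 by rewrite PT.
have ev_bound u A : baire R A -> `|ev u A| <= C.
  by move=> mA; rewrite (le_trans (signed_measure_le_tv x0 _ mA))// K_tv.
(* Dynkin induction: at a cozero set the value is a limit of integrals of continuous functions,
   which depend continuously on the measure. *)
have mev A : baire R A -> measurable_fun setT (fun u => ev u A).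
  have mT : measurable_fun setT (fun u => ev u [set: X]).
    have := ev_meas (fun m => sint x0 m (fun=> 1)) (csm _ _).
    rewrite (_ : _ \o _ = (fun u => ev u [set: X])).
      by apply; [exact: continuous_cst|apply: unit_bounded => x; rewrite ler01 lexx].
    by apply/funext => u /=; rewrite sint_cst mul1r.
  move: A; apply: (baire_induction x0) => [//|_ [f cf ->]|A mA PA|G mG tG PG].
  - have mf : baire R [set x | 0 < f x] by apply: (cozero_baire x0); exists f.
    apply: (measurable_realfun.measurable_fun_cvg
      (h := fun n u => sint x0 (ev u) (cozero_approx f n))) => [n|u _].
      apply: (ev_meas (fun m => sint x0 m (cozero_approx f n))); apply: csm.
        exact: cozero_approx_continuous.
      by apply: unit_bounded; exact: cozero_approx01.
    rewrite -(sint_indic x0 (ev u) mf); apply: (sint_bounded_cvg (C := 1)) => [n|n x|x].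
    + by apply: continuous_baire; exact: cozero_approx_continuous.
    + by have /andP[? ?] := cozero_approx01 f n x; rewrite ger0_norm.
    + exact: cozero_approx_cvg.
  - under eq_fun do rewrite (signed_measureC x0)//.
    exact: measurable_funB.
  - apply: (measurable_realfun.measurable_fun_cvg
      (h := fun n u => \sum_(0 <= i < n) ev u (G i))) => [n|u _].
      by apply: measurable_sum => i.
    by have [h _] := signed_measureP (ev u); exact: h.
pose nuf (A : set X) : R := \int[P]_u (ev u A).
have nufP : is_signed_measure nuf.
  split=> [G mG tG|A nA]; last first.
    rewrite /nuf (_ : (fun u => _) = fun=> 0) ?Rintegral_cst// ?mul0r//.
    by apply/funext => u; have [_] := signed_measureP (ev u); apply.
  have mUG : baire R (\bigcup_n G n) by exact: (@bigcupT_measurable _ bs).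
  have iG i : P.-integrable setT (EFin \o (fun u => ev u (G i))).
    by apply: (@bounded_integrable _ _ _ _ _ _ _ C) => [//||u _]; [exact: mev|exact: ev_bound].
  rewrite (_ : (fun n => _) = (fun n => \int[P]_u (\sum_(i < n) ev u (G i)))); last first.
    apply/funext => n; rewrite big_mkord.
    by have [-> _] := @Rintegral_sum _ _ _ P setT measurableT (fun i u => ev u (G i)) n (fun i _ => iG i).
  apply: (@Rintegral_bounded_cvg _ _ _ P setT measurableT _ _ C) => [n|n u _|u _].
  - by apply: measurable_sum => i; exact: mev.
  - rewrite -(signed_measure_bigsetU x0)//; apply: ev_bound.
    by apply: (@bigsetU_measurable _ bs) => i _; exact: mG.
  - have [h _] := signed_measureP (ev u).
    by have := h _ mG tG; under eq_fun do rewrite big_mkord.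
have nufS : nuf \in signed_measure_pred (R := R) (X := X) by apply/asboolP.
pose nu : M := SignedMeasure nufS.
have nuE A : nu A = \int[P]_u (ev u A) by [].
have unit_eq (f : X -> R) : continuous f -> (forall x, 0 <= f x <= 1) ->
    sint x0 nu f = I (fun m => sint x0 m f).
  move=> cf f01; have cI := csm cf (unit_bounded f01).
  have uf : unit_measurable bs R f by split => //; exact: continuous_baire.
  have ml := ev_meas _ cI.
  have il : P.-integrable setT (EFin \o (fun u => sint x0 (ev u) f)).
    apply: (@bounded_integrable _ _ _ _ _ _ _ C) => // u _.
    by rewrite (le_trans (sint_norm_le _ uf))// K_tv.
  have iA (i : nat) n : P.-integrable setT
      (EFin \o (fun u => ev u [set x | i.+1%:R / n.+1%:R <= f x])).
    have mA : baire R [set x | i.+1%:R / n.+1%:R <= f x] by apply: (layer_baire (x0 := x0)); exact: uf.1.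
    by apply: (@bounded_integrable _ _ _ _ _ _ _ C) => [//||u _]; [exact: mev|exact: ev_bound].
  rewrite -(ev_int _ cI); apply/eqP; rewrite -subr_eq0; apply/eqP.
  apply: (@eq0_of_le_inv _ _ (tv x0 nu + C)) => n.
  have [S1 S2] := @Rintegral_sum _ _ _ P setT measurableT
    (fun i u => ev u [set x | i.+1%:R / n.+1%:R <= f x]) n.+1 (fun i _ => iA i n).
  have iL : P.-integrable setT (EFin \o (fun u => layer_sum f n (ev u))).
    exact: (integrableZl measurableT _ S2).
  have LE : layer_sum f n nu = \int[P]_u (layer_sum f n (ev u)).
    by rewrite /layer_sum RintegralZl// S1.
  have h1 := sint_layer nu n uf.
  have h2 : `|\int[P]_u (sint x0 (ev u) f - layer_sum f n (ev u))| <=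
      n.+1%:R^-1 * C.
    rewrite -[leRHS]mulr1 -[X in _ <= _ * X]fPT; apply: Rintegral_norm_le => // [|u _].
      apply/measurable_EFinP; apply: (measurable_int P).
      exact: (integrableB measurableT il iL).
    by apply: (le_trans (sint_layer _ n uf)); apply: ler_wpM2l => //; exact: K_tv.
  rewrite RintegralB// -LE in h2.
  have -> : sint x0 nu f - \int[P]_u sint x0 (ev u) f =
      (sint x0 nu f - layer_sum f n nu) - (\int[P]_u sint x0 (ev u) f - layer_sum f n nu) by ring.
  by rewrite (le_trans (ler_normB _ _))// mulrDr lerD.
have nu_eq (f : X -> R) : continuous f -> bounded_fun f ->
    sint x0 nu f = I (fun m => sint x0 m f).
  move=> cf bf; have [L [_ fL]] := bf.
  pose B := `|L| + 1; have B0 : 0 < B by rewrite ltr_wpDl.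
  have fB x : `|f x| <= B by apply: fL => //; rewrite /B ltr_pwDr// ler_norm.
  have ug := unit_rescale B0 fB (continuous_baire (x0 := x0) cf).
  set g := (fun x => _) in ug.
  have cg : continuous g.
    by apply: continuous_fun_add; apply: continuous_fun_mul => //; exact: continuous_cst.
  have c1 := @continuous_cst R X 1.
  have o1 (x : X) : 0 <= (1 : R) <= 1 by rewrite ler01 lexx.
  have b1 := bounded_baire_cst x0 1.
  have fE m : sint x0 m f = 2 * B * sint x0 m g + - B * sint x0 m (fun=> 1).
    rewrite -sint_lin//; last exact: unit_bounded_baire.
    congr sint; apply/funext => x; rewrite /g; field; by rewrite gt_eqF.
  rewrite fE (unit_eq g cg ug.2) (unit_eq _ c1 o1) -I_linear.
  - by congr I; apply/funext => m; rewrite fE.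
  - by apply: csm => //; apply: unit_bounded; exact: ug.2.
  - by apply: csm => //; exact: unit_bounded.
exists nu; split => // D cD convD KD.
have fst_cvg : fst @ F --> nu.
  apply: cvg_weak_star => f cf bf; rewrite (smintegralE x0E) (nu_eq _ cf bf).
  have h : (fun p => p.2 (fun m => sint x0 m f)) @ F --> I (fun m => sint x0 m f).
    by apply: F_cvg; exact: csm.
  suff : (fun p : M * ((M -> R) -> R) => smintegral p.1 f) @ F -->
      I (fun m => sint x0 m f) by [].
  apply: cvg_trans h; apply: near_eq_cvg.
  apply: filterS F_conv => p /= pc; rewrite (smintegralE x0E).
  apply: (conv_eval_self pc) => m m' a b; apply: sint_lincomb.
  have [L [_ fL]] := bf; split; first exact: continuous_baire.
  by exists (`|L| + 1) => x; apply: fL => //; rewrite ltr_pwDr// ler_norm.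
have FD : \near F, D (fst F).
  by apply: filterS F_conv => p /= pc; exact: conv_eval_hull pc convD KD.
exact: (closed_cvg D cD FD nu fst_cvg).
Qed.
End barycentre.

(** * Separation from a singular measure *)

Section finite_measure_add.
Context d (T : measurableType d) (R : realType).
Variables m1 m2 : {finite_measure set T -> \bar R}.

Definition fmeasure_add : set T -> \bar R := measure_add m1 m2.

HB.instance Definition _ := Measure.on fmeasure_add.

Let fmeasure_add_fin : fin_num_fun fmeasure_add.
Proof.
move=> A mA; rewrite /fmeasure_add measure_addE fin_numD.
by rewrite !fin_num_measure.
Qed.

HB.instance Definition _ :=
  @Measure_isFinite.Build _ _ _ fmeasure_add fmeasure_add_fin.

Lemma Rintegral_fmeasure_add (f : T -> R) :
  m1.-integrable setT (EFin \o f) -> m2.-integrable setT (EFin \o f) ->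
  \int[fmeasure_add]_x f x = \int[m1]_x f x + \int[m2]_x f x.
Proof.
move=> i1 i2; rewrite /Rintegral integral_measure_add//.
by rewrite fineD//; exact: integrable_fin_num.
Qed.

End finite_measure_add.

Section compact_separation.
Context (R : realType) (X : topologicalType) (x0 : X).
Local Notation bs := (baire_space R x0).
Local Notation M := (signed_measure R X).
Hypothesis x0E : some_point X = Some x0.

Definition varm (nu : M) := fmeasure_add (pospart x0 nu) (negpart x0 nu).

Lemma varm_int nu f : bounded_baire x0 f -> \int[varm nu]_x f x = vint x0 nu f.
Proof.
by move=> bf; rewrite Rintegral_fmeasure_add//; exact: bounded_baire_integrable.
Qed.

Lemma unit_cont (f : X -> R) : continuous f -> (forall x, 0 <= f x <= 1) ->
  unit_measurable bs R f.
Proof. by move=> cf f01; split => //; exact: continuous_baire. Qed.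

Lemma unit_onem (f : X -> R) : unit_measurable bs R f ->
  unit_measurable bs R (fun x => 1 - f x).
Proof.
move=> [mf f01]; split; first exact: measurable_funB.
by move=> x; have /andP[? ?] := f01 x; apply/andP; split; lra.
Qed.

Lemma unit_indic (A : set X) : baire R A -> unit_measurable bs R (\1_A : X -> R).
Proof. by move=> mA; split => [|x]; [exact: measurable_indic|exact: indic01]. Qed.

Lemma unit_normB (f g : X -> R) : unit_measurable bs R f -> unit_measurable bs R g ->
  unit_measurable bs R (fun x => `|f x - g x|).
Proof.
move=> [mf f01] [mg g01]; split.
  by apply: measurableT_comp => //; exact: measurable_funB.
move=> x; have /andP[? ?] := f01 x; have /andP[? ?] := g01 x.
by rewrite normr_ge0/= ler_norml; apply/andP; split; lra.
Qed.

Lemma vint_indic0 (nu : M) (A : set X) : baire R A -> pospart x0 nu A = 0%E ->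
  negpart x0 nu A = 0%E -> vint x0 nu \1_A = 0.
Proof.
by move=> mA pA nA; rewrite /vint /Rintegral !integral_indic//= !setIT pA nA/= addr0.
Qed.

(** If [mu] sits on [A], then [~] A[is null for]|mu|[and]A[is null for]|nu|[. A continuous
    approximation of the indicator of]~[A] in L^1 of [|mu| + |nu|] serves both bounds. *)
Lemma singular_separation (mu nu : M) (e : R) : 0 < e -> mutually_singular mu nu ->
  exists f : X -> R, [/\ continuous f, forall x, 0 <= f x <= 1,
    vint x0 mu f < e & vint x0 nu (fun x => 1 - f x) < e].
Proof.
move=> e0 [A [B [mA mB AB muA nuB]]].
have mCA : baire R (~` A) by exact: (@measurableC _ bs).
have [pmu nmu] := null_parts x0 mCA muA.
have [pnu nnu] : pospart x0 nu A = 0%E /\ negpart x0 nu A = 0%E.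
  apply: null_parts => // E mE EA; apply: nuB => // x /EA Ax Bx.
  by have : (A `&` B) x by []; rewrite AB.
have [f [cf f01 fe]] := continuous_dense_L1 (fmeasure_add (varm mu) (varm nu)) mCA e0.
have uf := unit_cont cf f01.
have uA := unit_indic mCA; have uA' := unit_indic mA.
have uB := unit_normB uf uA.
have bB := unit_bounded_baire uB.
rewrite Rintegral_fmeasure_add ?varm_int// in fe; last 2 first.
- exact: bounded_baire_integrable.
- exact: bounded_baire_integrable.
have v0 m : 0 <= vint x0 m (fun x => `|f x - \1_(~` A) x|) by exact: vint_ge0.
have tri m A' (g : X -> R) : baire R A' -> unit_measurable bs R g ->
    (forall x, g x <= \1_A' x + `|f x - \1_(~` A) x|) ->
    vint x0 m \1_A' = 0 -> vint x0 m g <= vint x0 m (fun x => `|f x - \1_(~` A) x|).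
  move=> mA' ug gle vA'.
  have bA' := unit_bounded_baire (unit_indic mA').
  have := vint_lin m 1 1 bA' bB; rewrite vA' mulr0 add0r mul1r => <-.
  apply: le_vint => [||x]; [exact: unit_bounded_baire|exact: bounded_baire_lin|].
  by rewrite !mul1r.
exists f; split => //.
  apply: le_lt_trans (tri mu _ f mCA uf _ (vint_indic0 mCA pmu nmu)) _.
    by move=> x; have := ler_norm (f x - \1_(~` A) x); lra.
  by have := v0 nu; lra.
apply: le_lt_trans (tri nu _ _ mA (unit_onem uf) _ (vint_indic0 mA pnu nnu)) _.
  move=> x; have := ler_norm (- (f x - \1_(~` A) x)); rewrite normrN !indicE in_setC.
  by case: (x \in A) => /=; lra.
by have := v0 mu; lra.
Qed.

Lemma sint_sum nu (h : X -> R) (w : nat -> R) (f : nat -> X -> R) n :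
  bounded_baire x0 h -> (forall i, (i < n)%N -> bounded_baire x0 (f i)) ->
  bounded_baire x0 (fun x => \sum_(i < n) w i * f i x) /\
  sint x0 nu (fun x => h x * \sum_(i < n) w i * f i x) =
    \sum_(i < n) w i * sint x0 nu (fun x => h x * f i x) /\
  vint x0 nu (fun x => \sum_(i < n) w i * f i x) =
    \sum_(i < n) w i * vint x0 nu (f i).
Proof.
move=> bh; elim: n => [|n IH] bf.
  rewrite !big_ord0 (_ : (fun x => \sum_(i < 0) w i * f i x) = fun=> 0); last first.
    by apply/funext => x; rewrite big_ord0.
  rewrite (_ : (fun x => h x * _) = fun=> 0); last first.
    by apply/funext => x; rewrite big_ord0 mulr0.
  split; first exact: bounded_baire_cst.
  by rewrite sint_cst mul0r /vint !Rintegral_cst// !mul0r addr0.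
have [i ilt|b1 [s1 v1]] := IH; first by apply: bf; exact: ltnW.
have bn := bf n (leqnn _).
rewrite (_ : (fun x => \sum_(i < n.+1) w i * f i x) =
    (fun x => 1 * (\sum_(i < n) w i * f i x) + w n * f n x)); last first.
  by apply/funext => x; rewrite big_ord_recr/= mul1r.
rewrite (_ : (fun x => h x * \sum_(i < n.+1) w i * f i x) =
    (fun x => 1 * (h x * \sum_(i < n) w i * f i x) + w n * (h x * f n x))); last first.
  by apply/funext => x; rewrite big_ord_recr/=; ring.
split; first exact: bounded_baire_lin.
rewrite sint_lin ?vint_lin ?s1 ?v1 ?mul1r ?big_ord_recr//; exact: bounded_baireM.
Qed.

(** The two requirements on [f] are merged into a payoff [Lf f nu], affine in both variables, with
    [|mu|(f)] as a penalty. Without a good [f] each payoff reaches [e] on [K]; the barycentre then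
    has all payoffs at least [e / 2], which [singular_separation] refutes. *)
Lemma compact_separation (mu : M) (K : set M) (h : X -> R) (e d : R) :
  0 < e -> 0 < d -> compact K -> continuous h -> (forall x, -1 <= h x <= 1) ->
  (forall nu, K nu -> tv x0 nu <= sint x0 nu h + e) ->
  (forall nu, (forall D : set M, closed D -> @convex_set R M D -> K `<=` D -> D nu) ->
    tv x0 nu <= sint x0 nu h + e /\ mutually_singular mu nu) ->
  exists f : X -> R, [/\ continuous f, forall x, 0 <= f x <= 1,
    vint x0 mu f < d & forall nu, K nu -> sint x0 nu (fun x => h x * (1 - f x)) < e].
Proof.
move=> e0 d0 cK ch h11 Kh hull.
have v0 (g : X -> R) : (forall x, 0 <= g x <= 1) -> 0 <= vint x0 mu g.
  by move=> g01; apply: vint_ge0 => x; have /andP[] := g01 x.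
have bh : bounded_baire x0 h.
  by split; [exact: continuous_baire|exists 1 => x; rewrite ler_norml].
have [->|/set0P K0] := eqVneq K set0.
  exists (fun=> 0); split => //; first exact: continuous_cst.
    by move=> _; rewrite lexx ler01.
  by rewrite /vint !Rintegral_cst// !mul0r addr0.
apply: contrapT => nof.
(* When [|mu|(f)] is at least [d] the penalty is at least [2 e], which outweighs
   [nu(h (1 - f)) >= - e] and leaves a payoff of at least [e]. *)
pose l : R := 2 * e / d.
have l0 : 0 < l by rewrite divr_gt0// mulr_gt0.
pose unitc := [set f : X -> R | continuous f /\ forall x, 0 <= f x <= 1].
pose Lf (f : X -> R) (nu : M) : R :=
  sint x0 nu (fun x => h x * (1 - f x)) + l * vint x0 mu f.
have c1B (f : X -> R) : continuous f -> continuous (fun x => h x * (1 - f x)).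
  move=> cf; apply: continuous_fun_mul => //; apply: continuous_fun_sub => //.
  exact: continuous_cst.
have bnd (f : X -> R) : unitc f -> bounded_fun (fun x => h x * (1 - f x)).
  move=> [_ f01]; exists 1; split; first exact: num_real.
  move=> y y1 x _ /=; have /andP[? ?] := h11 x; have /andP[? ?] := f01 x.
  by apply: le_trans (ltW y1); rewrite ler_norml; apply/andP; split; nra.
have csint (f : X -> R) : unitc f -> continuous (fun nu : M => sint x0 nu (fun x => h x * (1 - f x))).
  move=> uf; have := smintegral_continuous (c1B _ uf.1) (bnd _ uf).
  by under eq_fun do rewrite (smintegralE x0E).
have Lge (f : X -> R) : unitc f -> exists2 nu, K nu & e <= Lf f nu.
  move=> [cf f01]; have [vd|vd] := ltP (vint x0 mu f) d.
    have [[nu Knu enu]|nK] := pselect (exists2 nu, K nu & e <= sint x0 nu (fun x => h x * (1 - f x))).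
      by exists nu => //; rewrite (le_trans enu)// lerDl mulr_ge0 ?(ltW l0)// v0.
    exfalso; apply: nof; exists f; split => // nu Knu; rewrite ltNge; apply/negP => enu.
    by apply: nK; exists nu.
  have [nu Knu] := K0; exists nu => //.
  have /andP[_ h1] := vint_norming bh h11 (Kh _ Knu) (unit_onem (unit_cont cf f01)).
  have h2 : 0 <= vint x0 nu (fun x => 1 - f x).
    by apply: vint_ge0 => x; have /andP[? ?] := f01 x; rewrite subr_ge0.
  have h3 : 2 * e <= l * vint x0 mu f.
    by rewrite /l mulrAC ler_pdivlMr// ler_pM2l// mulr_gt0.
  by rewrite /Lf; lra.
have Lsum n (w : nat -> R) (f : nat -> X -> R) nu : (forall i, (i < n)%N -> unitc (f i)) ->
    \sum_(i < n) w i = 1 ->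
    Lf (fun x => \sum_(i < n) w i * f i x) nu = \sum_(i < n) w i * Lf (f i) nu.
  move=> uf w1.
  have bf i : (i < n)%N -> bounded_baire x0 (f i).
    by move=> ilt; have [? ?] := uf _ ilt; apply: unit_bounded_baire; exact: unit_cont.
  have hB (g : X -> R) : bounded_baire x0 g ->
      sint x0 nu (fun x => h x * (1 - g x)) = sint x0 nu h - sint x0 nu (fun x => h x * g x).
    move=> bg; rewrite (_ : (fun x => _) = (fun x => 1 * h x + (- 1) * (h x * g x))).
      by rewrite sint_lin ?mul1r ?mulN1r//; exact: bounded_baireM.
    by apply/funext => x; ring.
  have [b1 [s1 _]] := sint_sum nu w bh bf.
  have [_ [_ v1]] := sint_sum mu w bh bf.
  rewrite /Lf hB// s1 v1.
  rewrite [RHS](eq_bigr (fun i : 'I_n => w i * sint x0 nu h - w i * sint x0 nu (fun x => h x * f i x) +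
      l * (w i * vint x0 mu (f i)))).
    by rewrite big_split sumrB/= -mulr_suml w1 mul1r mulr_sumr.
  by move=> i _; rewrite hB; [ring|exact: bf].
have unitc_sum n (w : nat -> R) (f : nat -> X -> R) : (forall i, (i < n)%N -> unitc (f i)) ->
    (forall i, 0 <= w i) -> \sum_(i < n) w i = 1 ->
    unitc (fun x => \sum_(i < n) w i * f i x).
  move=> uf w0 w1; split.
    pose g (i : nat) (x : X) := w i * (if (i < n)%N then f i else fun=> 0) x.
    rewrite (_ : (fun x => _) = (fun x => \sum_(i < n) g i x)).
      apply: (@continuous_fun_sum R X g) => i.
      apply: continuous_fun_mul; first exact: continuous_cst.
      by case: ifPn => [/uf[]//|_]; exact: continuous_cst.
    by apply/funext => x; apply: eq_bigr => i _; rewrite /g ltn_ord.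
  move=> x; apply/andP; split.
    apply: sumr_ge0 => i _; have [_ /(_ x)/andP[? _]] := uf _ (ltn_ord i).
    by rewrite mulr_ge0.
  rewrite -w1; apply: ler_sum => i _; have [_ /(_ x)/andP[_ ?]] := uf _ (ltn_ord i).
  by rewrite ler_piMr.
have e2e : e / 2 < e by lra.
have [||FF [I [PF Fc Fcv Ige]]] := @minimax_functional R M (Topological.class M) K cK K0
    [set Lf f | f in unitc] e (e / 2) e2e.
- move=> _ [f uf <-]; apply: continuous_fun_add; first exact: csint.
  exact: continuous_cst.
- move=> n w g w0 w1 gL.
  have /choice[f fP] : forall i, exists f : X -> R, (i < n)%N -> unitc f /\ Lf f = g i.
    move=> i; have [ilt|] := boolP (i < n)%N; last by exists (fun=> 0).
    by have [f uf fE] := gL i ilt; exists f.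
  have uf i : (i < n)%N -> unitc (f i) by move=> /fP[].
  have [nu Knu enu] := Lge _ (unitc_sum n w f uf w0 w1); exists nu => //.
  rewrite Lsum// in enu; apply: le_trans enu _; rewrite le_eqVlt; apply/orP; left.
  by apply/eqP; apply: eq_bigr => i _; have [_ ->] := fP i (ltn_ord i).
(* The variation need not be continuous, but on [K] it is at most [sint x0 m h + e], a continuous
   function on a compact set. *)
have [C KC] : exists C, forall m, K m -> tv x0 m <= C.
  have ch' : continuous (fun nu : M => sint x0 nu h).
    have bfh : bounded_fun h.
      exists 1; split; first exact: num_real.
      by move=> y y1 x _ /=; apply: le_trans (ltW y1); rewrite ler_norml.
    have := smintegral_continuous ch bfh.
    by under eq_fun do rewrite (smintegralE x0E).
  have [n Kn] : exists n, K `<=` [set m | 0 < n%:R - sint x0 m h].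
    apply: compact_nondecreasing_cover => // [n|n p np m /=|m Km].
    - apply: open_lt_preimage; apply: continuous_fun_sub => //; exact: continuous_cst.
    - by rewrite !subr_gt0 => /lt_le_trans; apply; rewrite ler_nat.
    - exists (Num.truncn `|sint x0 m h|).+1 => //=; rewrite subr_gt0.
      by rewrite (le_lt_trans (ler_norm _))// truncnS_gt.
  exists (n%:R + e) => m Km; rewrite (le_trans (Kh _ Km))// lerD2r ltW//.
  by have := Kn _ Km => /=; rewrite subr_gt0.
have [nu [nuI nuD]] := barycentre x0E cK KC PF Fc Fcv.
have [nuh munu] := hull _ nuD.
have nuL (f : X -> R) : unitc f -> e / 2 <= Lf f nu.
  move=> uf; rewrite (le_trans (Ige (Lf f) _))//; first by exists f.
  rewrite /Lf (nuI _ (c1B _ uf.1) (bnd _ uf)); set c := l * _.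
  set g := fun m : M => sint x0 m _.
  have gc : (fun p : M * ((M -> R) -> R) => p.2 (fun m => g m + c)) @ FF --> I g + c.
    have : (fun p : M * ((M -> R) -> R) => p.2 g + c) @ FF --> I g + c.
      by apply: cvgD; [apply: Fcv; exact: csint|exact: cvg_cst].
    apply: cvg_trans; apply: near_eq_cvg; apply: filterS Fc => p /= pc.
    have := conv_eval_linear pc g (fun=> 1) 1 c.
    rewrite mul1r (conv_eval_cst 1 pc) mulr1 => <-.
    by congr (p.2 _); apply/funext => m; rewrite mul1r ?mulr1.
  have cgc : continuous (fun m : M => g m + c).
    by apply: continuous_fun_add; [exact: csint|exact: continuous_cst].
  by rewrite -(cvg_lim _ gc)// -(cvg_lim _ (Fcv _ cgc)).
(* The payoff at the separating [f] is then below [eta + l * eta = e / 4], less than [e / 2]. *)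
pose eta : R := e / (4 * (1 + l)).
have eta0 : 0 < eta by rewrite divr_gt0// mulr_gt0//; lra.
have [f [cf f01 muf nuf]] := singular_separation eta0 munu.
have := nuL f (conj cf f01); rewrite leNgt => /negP; apply.
have /andP[h1 _] := vint_norming bh h11 nuh (unit_onem (unit_cont cf f01)).
have etaE : eta + l * eta = e / 4 by rewrite /eta; field; rewrite gt_eqF//; lra.
have : l * vint x0 mu f < l * eta by rewrite ltr_pM2l.
by rewrite /Lf; lra.
Qed.

End compact_separation.
Arguments varm {R X} x0 nu _.

(** * From compact pieces to a whole trace *)

Section analytic_separation.
Context (R : realType) (X : topologicalType) (x0 : X).
Local Notation bs := (baire_space R x0).
Local Notation M := (signed_measure R X).
Hypothesis x0E : some_point X = Some x0.
Variables (mu : M) (phi : baire_seq -> set M) (h : X -> R) (e : R).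
Hypotheses (e0 : 0 < e) (phi_usco : usco phi).
Hypotheses (h_cont : continuous h) (h11 : forall x, -1 <= h x <= 1).
Hypothesis phi_norming : forall s nu, phi s nu -> tv x0 nu <= sint x0 nu h + e.
Hypothesis phi_hull : forall K nu, compact K ->
  (forall D : set M, closed D -> @convex_set R M D -> \bigcup_(s in K) phi s `<=` D -> D nu) ->
  tv x0 nu <= sint x0 nu h + e /\ mutually_singular mu nu.

Let m := varm x0 mu.

Let FF (A : set baire_seq) : set (X -> R) := [set F : X -> R | unit_measurable bs R F /\
  forall s nu, A s -> phi s nu -> vint x0 nu (fun x => 1 - F x) <= 2 * e].

Let bh : bounded_baire x0 h.
Proof. by split; [exact: continuous_baire|exists 1 => x; rewrite ler_norml]. Qed.

Let one_sub_bounded (F : X -> R) : unit_measurable bs R F ->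
  bounded_baire x0 (fun x => 1 - F x).
Proof. by move=> uF; apply: unit_bounded_baire; exact: unit_onem. Qed.

(* [good d A] says that the capacity [inf { |mu|(F^2) | F in FF A }] of [A] is
   at most [d]; the square makes near-minimizers [L^2]-Cauchy. *)
Let good (d : R) (A : set baire_seq) := forall r : R, 0 < r ->
  exists2 F, FF A F & \int[m]_x F x ^+ 2 <= d + r.

(** The families [FF (A i)] decrease with [i] and are stable under midpoints, since [|nu|(1 - F)] is
    affine in [F]; this is the setting of [going_up]. *)
Let good_bigcup d (A : nat -> set baire_seq) :
  (forall i j, (i <= j)%N -> A i `<=` A j) -> (forall i, good d (A i)) ->
  good d (\bigcup_i A i).
Proof.
move=> ndA gA r r0; have r2 : 0 < r / 2 by rewrite divr_gt0.
have [|||||F FA Fd] := @going_up _ bs R m (fun i => FF (A i)) _ _ _ _ (d + r / 2) (r / 2) r2.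
- by move=> n F [].
- by move=> n p np F [uF vF]; split => // s nu As; apply: vF; exact: ndA As.
- move=> n F G [uF vF] [uG vG]; split.
    split; first by apply: measurable_funM => //; apply: measurable_funD; [exact: uF.1|exact: uG.1].
    move=> x; have /andP[? ?] := uF.2 x; have /andP[? ?] := uG.2 x.
    by apply/andP; split; lra.
  move=> s nu As snu; rewrite (_ : (fun x => _) =
      (fun x => 2^-1 * (1 - F x) + 2^-1 * (1 - G x))); last by apply/funext => x; field.
  rewrite vint_lin; [|exact: one_sub_bounded|exact: one_sub_bounded].
  by have := vF _ _ As snu; have := vG _ _ As snu; lra.
- move=> n F G [uF vF] uG FG; split => // s nu As snu; apply: le_trans (vF _ _ As snu).
  by apply: le_vint => [||x]; [exact: one_sub_bounded|exact: one_sub_bounded|rewrite lerD2l lerN2].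
- by move=> n; exact: (gA n _ r2).
exists F; last by rewrite (le_trans Fd)// -addrA -splitr.
split; first by have [] := FA 0%N.
by move=> s nu [i _ As]; have [_] := FA i; apply.
Qed.

(** Otherwise Choquet's scheme gives a sequence [n] all of whose sets [bounded_prefix k n] are bad.
    The compact set [bounded_by n] has a separating [f], which by openness still works on one of
    these sets. *)
Let good_all d : 0 < d -> good d setT.
Proof.
move=> d0; apply: contrapT => bad.
have [|||n n0 badn] := @choquet_scheme (fun A => ~ good d A).
- exact: bad.
- move=> A ndA bA; apply: contrapT => nb; apply: bA; apply: good_bigcup => // i.
  by apply: contrapT => ?; apply: nb; exists i.
- move=> A B AB bA gB; apply: bA => r r0; have [F [uF vF] Fd] := gB r r0.
  by exists F => //; split => // s nu /AB; exact: vF.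
have cK := bounded_by_compact (n := n).
have [|||||f [cf f01 muf Kf]] := @compact_separation _ _ _ x0E mu
    (\bigcup_(s in bounded_by n) phi s) h e d e0 d0.
- exact: usco_compact_image.
- exact: h_cont.
- exact: h11.
- by move=> nu [s _ snu]; exact: phi_norming snu.
- by move=> nu; exact: phi_hull.
have uf := unit_cont x0 cf f01.
(* Expressed through [h], the condition on [nu] is weak* open; this is what lets it spread from the
   compact set to a neighbourhood. *)
pose G := [set nu : M | 0 < e - sint x0 nu (fun x => h x * (1 - f x))].
have oG : open G.
  apply: open_lt_preimage; apply: continuous_fun_sub; first exact: continuous_cst.
  have ch1 : continuous (fun x => h x * (1 - f x)).
    apply: continuous_fun_mul => //; apply: continuous_fun_sub => //.
    exact: continuous_cst.
  have bh1 : bounded_fun (fun x => h x * (1 - f x)).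
    exists 1; split; first exact: num_real.
    move=> y y1 x _ /=; have /andP[? ?] := h11 x; have /andP[? ?] := f01 x.
    by apply: le_trans (ltW y1); rewrite ler_norml; apply/andP; split; nra.
  have := smintegral_continuous ch1 bh1.
  by under eq_fun do rewrite (smintegralE x0E).
have [k kG] : exists k, bounded_prefix k n `<=` [set s | phi s `<=` G].
  apply: bounded_by_tube n0; first exact: phi_usco.2.
  by move=> s ns nu snu; rewrite /G /= subr_gt0; apply: Kf; exists s.
apply: (badn k) => r r0; exists f.
  split => // s nu sk snu.
  have := kG _ sk _ snu; rewrite /G /= subr_gt0 => h1.
  have /andP[_ h2] := vint_norming bh h11 (phi_norming snu) (unit_onem uf).
  by lra.
have uf2 := unit_sqr_integrable m uf.
apply: (@le_trans _ _ (\int[m]_x f x)); last first.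
  by rewrite varm_int ?(le_trans (ltW muf))// ?lerDl ?(ltW r0)//; exact: unit_bounded_baire.
apply: le_Rintegral => //; first by apply: unit_integrable => //; exact: uf.1.
by move=> x _; have /andP[? ?] := f01 x; rewrite expr2 ler_piMl.
Qed.

Lemma analytic_separation d : 0 < d -> exists2 F : X -> R, unit_measurable bs R F &
  \int[m]_x F x ^+ 2 <= d /\
  forall s nu, phi s nu -> vint x0 nu (fun x => 1 - F x) <= 2 * e.
Proof.
move=> d0; have d2 : 0 < d / 2 by rewrite divr_gt0.
have [F [uF vF] Fd] := good_all d2 d2; exists F => //; split; first by rewrite [leRHS]splitr.
by move=> s nu; exact: vF.
Qed.

(** Markov's inequality, used with [c = 4] for [F ^ 2] and with [c = 2] for [1 - F]. *)
Lemma fine_le_Rintegral (p : {finite_measure set bs -> \bar R}) (A : set X) (g : X -> R) (c : R) :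
  baire R A -> bounded_baire x0 g -> 0 <= c -> (forall x, 0 <= g x) ->
  (forall x, A x -> 1 <= c * g x) -> fine (p A) <= c * \int[p]_x g x.
Proof.
move=> mA bg c0 g0 Ag.
have -> : fine (p A) = \int[p]_x \1_A x by rewrite /Rintegral integral_indic//= setIT.
have ig := bounded_baire_integrable p bg.
rewrite -RintegralZl//; apply: le_Rintegral => //.
- by apply: bounded_baire_integrable; apply: unit_bounded_baire; exact: unit_indic.
- exact: (integrableZl measurableT c ig).
- move=> x _; rewrite indicE; have [/set_mem/Ag//|_] := boolP (x \in A).
  by rewrite mulr_ge0.
Qed.

(** The upper limit of the sets [F j > 1 / 2] is [|mu|]-null by the Borel-Cantelli lemma. Its
    complement is the increasing union of the [D n]; there [1 - F n >= 1 / 2], so [|nu|(D n)] is at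
    most twice [2 e]. *)
Lemma null_separation : exists E : set X, [/\ baire R E, m E = 0%E &
  forall s nu, phi s nu -> fine (varm x0 nu (~` E)) <= 4 * e].
Proof.
(* The factor 1/4 cancels the 4 in Markov's inequality at the level 1/2 of [F], leaving summable
   bounds. *)
have d0 (j : nat) : 0 < 4^-1 * (2^-1 : R) ^+ j.+1 by rewrite mulr_gt0 ?exprn_gt0.
have /choice[F FP] := fun j => (let: ex_intro2 F a b := analytic_separation (d0 j) in
  ex_intro (fun F : X -> R => unit_measurable bs R F /\ (\int[m]_x F x ^+ 2 <= 4^-1 * 2^-1 ^+ j.+1 /\
  forall s nu, phi s nu -> vint x0 nu (fun x => 1 - F x) <= 2 * e)) F (conj a b)).
pose E j := [set x | 2^-1 < F j x].
have mE j : baire R (E j).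
  have [[mF _] _] := FP j.
  rewrite -(baire_measurableE R x0) -[X in measurable X]setTI.
  rewrite /E (_ : [set x | _] = F j @^-1` `]2^-1, +oo[).
    by apply: mF => //; exact: measurable_itv.
  by apply/seteqP; split => x /=; rewrite in_itv/= andbT.
have mEle j : (m (E j) <= (2^-1 ^+ j.+1 : R)%:E)%E.
  have [uF [Fd _]] := FP j.
  have mfin : m (E j) \is a fin_num by apply: fin_num_measure; exact: mE.
  rewrite -(fineK mfin) lee_fin.
  have := @fine_le_Rintegral m (E j) (fun x => F j x ^+ 2) 4 (mE j).
  have -> : (2^-1 : R) ^+ j.+1 = 4 * (4^-1 * 2^-1 ^+ j.+1) by rewrite mulrA mulfV ?mul1r.
  move=> /(_ _ _ _ _)/le_trans; apply; last by rewrite ler_pM2l.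
  - apply: unit_bounded_baire; split; first by apply: measurable_funX; exact: uF.1.
    by move=> x; have /andP[? ?] := uF.2 x; rewrite sqr_ge0 expr_le1.
  - by [].
  - by move=> x; exact: sqr_ge0.
  - by move=> x; rewrite /E /= => ?; nra.
have mL : baire R (lim_sup_set E).
  by apply: (@bigcapT_measurable _ bs) => n; apply: (@bigcup_measurable _ bs) => k _; exact: mE.
exists (lim_sup_set E); split => //.
  apply: lim_sup_set_cvg0 => //; apply: le_lt_trans (ltry 1).
  have sumE n : \sum_(j < n) (2^-1 : R) ^+ j.+1 = 1 - 2^-1 ^+ n.
    elim: n => [|n IH]; first by rewrite big_ord0 expr0 subrr.
    by rewrite big_ord_recr/= IH exprS; field.
  apply: lime_le; first exact: is_cvg_nneseries.
  apply: nearW => n; rewrite big_mkord.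
  apply: (@le_trans _ _ (\sum_(j < n) ((2^-1 : R) ^+ j.+1)%:E)%E).
    by apply: lee_sum => j _; exact: mEle.
  by rewrite sumEFin lee_fin sumE gerBl exprn_ge0.
move=> s nu snu.
pose D n := ~` (\bigcup_(j >= n) E j).
have mD n : baire R (D n).
  by apply: (@measurableC _ bs); apply: (@bigcup_measurable _ bs) => k _; exact: mE.
have -> : ~` lim_sup_set E = \bigcup_n D n by rewrite /lim_sup_set setC_bigcap.
have cD : (fun n => fine (varm x0 nu (D n))) @ \oo --> fine (varm x0 nu (\bigcup_n D n)).
  apply: fine_cvg; rewrite fineK ?fin_num_measure//; last exact: (@bigcupT_measurable _ bs).
  apply: nondecreasing_cvg_mu => //; first exact: (@bigcupT_measurable _ bs).
  move=> i j ij; apply/subsetPset => x; apply: contra_not => -[k /= jk Ek].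
  by exists k => //=; exact: leq_trans jk.
rewrite -(cvg_lim _ cD)//; apply: limr_le; first by apply/cvg_ex; eexists; exact: cD.
apply: nearW => n; have [uF [_ /(_ _ _ snu) vF]] := FP n.
have := @fine_le_Rintegral (varm x0 nu) (D n) (fun x => 1 - F n x) 2 (mD n) (one_sub_bounded uF).
move=> /(_ _ _ _)/le_trans; apply.
- by [].
- by move=> x; have /andP[? ?] := uF.2 x; rewrite subr_ge0.
- move=> x Dx; have : ~ E n x by move=> Ex; apply: Dx; exists n => /=.
  by rewrite /E /= => /negP; rewrite -leNgt; lra.
- by rewrite varm_int//; [lra|exact: one_sub_bounded].
Qed.

End analytic_separation.

(** * Gluing over the countable norming set *)

Lemma null_bigcup d (T : measurableType d) (R : realType) (m : {measure set T -> \bar R})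
    (F : nat -> set T) : (forall n, measurable (F n)) -> (forall n, m (F n) = 0%E) ->
  m (\bigcup_n F n) = 0%E.
Proof.
move=> mF F0; apply/eqP; rewrite eq_le measure_ge0 andbT.
apply: le_trans (measure_sigma_subadditive m mF (bigcupT_measurable _ mF) (@subset_refl _ _)) _.
by rewrite eseries0.
Qed.

Lemma signed_measure0 (R : realType) (X : topologicalType) (nu : signed_measure R X) :
  nu set0 = 0.
Proof.
have [sigma_nu _] := signed_measureP nu.
have b0 (n : nat) : baire R (@set0 X) by exact: sigma_algebra0.
pose u n : R := \sum_(0 <= i < n) nu set0.
have cu : u @ \oo --> nu set0.
  have := sigma_nu (fun=> set0) b0 (@trivIset_set0 _ _ _).
  by rewrite bigcup0.
have : (fun n => u n.+1 - u n) @ \oo --> nu set0 - nu set0.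
  by apply: cvgB => //; rewrite (cvg_shiftS u).
rewrite subrr (_ : (fun n => _) = fun=> nu set0) => [/cvg_lim<-//|].
  by rewrite lim_cst.
by apply/funext => n; rewrite /u big_nat_recr//= addrAC subrr add0r.
Qed.

Theorem theorem11 (R : realType) (X : topologicalType)
    (N : set (signed_measure R X)) (H : set (X -> R)) (mu : signed_measure R X)
    (N_analytic : convexly_analytic N)
    (H_countable : countable H)
    (H_continuous : forall h, H h -> continuous h /\ forall x, -1 <= h x <= 1)
    (H_norming : forall nu, N nu -> smvariation nu [set: X] =
       ereal_sup [set (smintegral nu h)%:E | h in H])
    (mu_singular : forall nu, N nu -> mutually_singular mu nu) :
  exists B : set X, [/\ baire R B, sits_on mu B &
    forall nu, N nu -> sits_on nu (~` B)].
Proof.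
(* Integration is set up at a base point, so the empty space is treated apart; every signed measure
   on it is 0. *)
have [X0|[x0 x0E]] : [set: X] = set0 \/ exists x0, some_point X = Some x0.
- rewrite /some_point; case: pselect => [X0|nX]; first by right; eexists.
  by left; apply/eqP; apply: contra_notT nX => /set0P.
- have null (nu : signed_measure R X) E : nu E = 0.
    rewrite (_ : E = set0) ?signed_measure0//.
    by apply/seteqP; split => // x _; have : [set: X] x by []; rewrite X0.
  by exists set0; split => [|E _ _|nu _ E _ _] //; exact: sigma_algebra0.
pose M := signed_measure R X.
have [phi [phi_usco NE phi_hull]] := N_analytic.
(* Comparing with each [h'] rather than with [|nu|(X)] makes this an intersection of half-spaces of
   continuous linear functionals, hence closed and convex. On [N] the norming hypothesis turns it
   into [|nu|(X) <= nu(h) + e]. *)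
pose Dh (h : X -> R) (e : R) : set M :=
  [set nu | forall h', H h' -> sint x0 nu h' <= sint x0 nu h + e].
have bH h : H h -> bounded_baire x0 h.
  move=> /H_continuous[ch h11]; split; first exact: continuous_baire.
  by exists 1 => x; rewrite ler_norml.
have csint h : H h -> continuous (fun nu : M => sint x0 nu h).
  move=> /H_continuous[ch h11].
  have bfh : bounded_fun h.
    exists 1; split; first exact: num_real.
    by move=> y y1 x _ /=; apply: le_trans (ltW y1); rewrite ler_norml.
  have := smintegral_continuous ch bfh.
  by under eq_fun do rewrite (smintegralE x0E).
have Dh_closed h e : H h -> closed (Dh h e).
  move=> Hh; rewrite (_ : Dh h e = \bigcap_(h' in H)
      ~` [set nu | e < sint x0 nu h' - sint x0 nu h]).
    apply: closed_bigI => h' Hh'; apply: open_closedC; apply: open_lt_preimage.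
    by apply: continuous_fun_sub; exact: csint.
  apply/seteqP; split=> [nu hnu h' /hnu|nu hnu h' /hnu /= /negP].
    by move=> h1 /=; apply/negP; rewrite -leNgt lerBlDl.
  by rewrite -leNgt lerBlDl.
have Dh_convex h e : H h -> @convex_set R M (Dh h e).
  move=> Hh nu nu' l /set_mem Dnu /set_mem Dnu'; apply/mem_set => h' Hh'.
  have bh := bH _ Hh; have bh' := bH _ Hh'.
  have := Dnu _ Hh'; have := Dnu' _ Hh'.
  have l0 : 0 <= l%:num by []; have l1 : l%:num <= 1 by [].
  have := sint_lincomb (x0 := x0) nu nu' l%:num (1 - l%:num) bh.
  have := sint_lincomb (x0 := x0) nu nu' l%:num (1 - l%:num) bh'.
  move=> e1 e2 h1 h2.
  rewrite [X in sint x0 X h'](_ : _ = l%:num *: nu + (1 - l%:num) *: nu')//.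
  rewrite [X in sint x0 X h](_ : _ = l%:num *: nu + (1 - l%:num) *: nu')//.
  rewrite e1 e2; nra.
have tv_sup nu : N nu -> (tv x0 nu)%:E = ereal_sup [set (sint x0 nu h)%:E | h in H].
  move=> Nnu; rewrite -(smvariationE x0E) H_norming//; congr ereal_sup.
  by apply/seteqP; split=> [_ [h Hh <-]|_ [h Hh <-]]; exists h => //; rewrite (smintegralE x0E).
have tv_Dh nu h e : N nu -> H h -> Dh h e nu -> tv x0 nu <= sint x0 nu h + e.
  move=> Nnu Hh Dnu; rewrite -lee_fin tv_sup//; apply: ge_ereal_sup => _ [h' Hh' <-].
  by rewrite lee_fin; exact: Dnu.
have sep h e : H h -> 0 < e -> exists E : set X, [/\ baire R E, varm x0 mu E = 0%E &
    forall nu, N nu -> Dh h e nu -> fine (varm x0 nu (~` E)) <= 4 * e].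
  move=> Hh e0; have [ch h11] := H_continuous _ Hh.
  have [|K nu cK Knu|E [mE E0 EN]] := @null_separation R X x0 x0E mu
      (fun s => phi s `&` Dh h e) h e e0 (usco_setI phi_usco (Dh_closed h e Hh)) ch h11.
  - by move=> s nu [snu Dnu]; apply: tv_Dh => //; rewrite NE; exists s.
  (* A closed convex set containing the image of [K] under [phi] contains its trace on [Dh h e], so
     [nu] is in the closed convex hull of that image, which lies in [N]. *)
  - have Nnu : N nu.
      apply: (phi_hull K cK) => C [[cC convC] KC]; apply: Knu => // m [s Ks [sm _]].
      by apply: KC; exists s.
    have Dnu : Dh h e nu.
      by apply: Knu; [exact: Dh_closed|exact: Dh_convex|move=> m [s _ []]].
    by split; [exact: tv_Dh|exact: mu_singular].
  exists E; split => // nu; rewrite {1}NE => -[s _ snu] Dnu.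
  by apply: EN (s) _ _.
have /countable_injP[code code_inj] := H_countable.
(* Indexing by codes makes the final union run over pairs of naturals. A number coding no element of
   [H] gets the empty set. *)
have /choice[E EP] : forall nk : nat * nat, exists E : set X,
    [/\ baire R E, varm x0 mu E = 0%E &
      forall h nu, H h -> code h = nk.1 -> N nu -> Dh h nk.2.+1%:R^-1 nu ->
        fine (varm x0 nu (~` E)) <= 4 * nk.2.+1%:R^-1].
  move=> [n k] /=.
  have [[h [Hh hn]]|nh] := pselect (exists h, H h /\ code h = n); last first.
    exists set0; split; [exact: (@measurable0 _ (baire_space R x0))|exact: measure0|].
    by move=> h nu Hh hn; exfalso; apply: nh; exists h.
  have k0 : 0 < k.+1%:R^-1 :> R by rewrite invr_gt0.
  have [E [mE E0 EN]] := sep h _ Hh k0; exists E; split => // h' nu Hh' hn' Nnu.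
  have -> : h' = h by apply: code_inj; [exact: mem_set|exact: mem_set|rewrite hn hn'].
  exact: EN.
pose F n := \bigcup_k E (n, k); pose E0 := \bigcup_n F n.
have mF n : baire R (F n).
  by apply: (@bigcupT_measurable _ (baire_space R x0)) => k; have [] := EP (n, k).
have mE0 : baire R E0 by exact: (@bigcupT_measurable _ (baire_space R x0)).
have muE0 : varm x0 mu E0 = 0%E.
  apply: (null_bigcup (m := varm x0 mu)) => // n.
  by apply: (null_bigcup (m := varm x0 mu)) => k; have [] := EP (n, k).
have null_sits (nu : signed_measure R X) A : baire R A -> varm x0 nu A = 0%E -> sits_on nu (~` A).
  move=> mA A0 E' mE'; rewrite setCK => E'A.
  have [pA qA] : pospart x0 nu A = 0%E /\ negpart x0 nu A = 0%E.
    have : (pospart x0 nu A + negpart x0 nu A = 0)%E by rewrite -A0 /varm /fmeasure_add measure_addE.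
    by move/eqP; rewrite padde_eq0// => /andP[/eqP ? /eqP ?].
  exact: (parts_null mA mE' E'A pA qA).
have mC : baire R (~` E0) by exact: (@measurableC _ (baire_space R x0)).
exists (~` E0); split => //; first exact: null_sits.
move=> nu Nnu; apply: null_sits => //.
have fin : varm x0 nu (~` E0) \is a fin_num by apply: fin_num_measure.
rewrite -(fineK fin); congr EFin; apply: (@eq0_of_le_inv _ _ 4) => k.
rewrite ger0_norm ?fine_ge0// mulrC.
have k0 : 0 < k.+1%:R^-1 :> R by rewrite invr_gt0.
have sup_fin : ereal_sup [set (sint x0 nu h)%:E | h in H] \is a fin_num.
  by rewrite -tv_sup.
(* For each [k] some [h] nearly norms [nu], which places [nu] in the trace of [(code h, k)]. As [E0]
   contains the set of that pair, [|nu|] is at most [4 / k.+1] off [E0], for every [k]. *)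
have [_ [h Hh <-]] := ub_ereal_sup_adherent k0 sup_fin.
rewrite -tv_sup// -EFinB lte_fin ltrBlDr => tvh.
have [mE _ EN] := EP (code h, k).
have Dnu : Dh h k.+1%:R^-1 nu.
  move=> h' Hh'; rewrite (le_trans _ (ltW tvh))// -lee_fin tv_sup//.
  by apply: ereal_sup_ubound; exists h'.
apply: le_trans (EN h nu Hh erefl Nnu Dnu); apply: fine_le => //.
  by apply: fin_num_measure; exact: (@measurableC _ (baire_space R x0)).
apply: le_measure; [exact: mem_set|apply: mem_set; exact: (@measurableC _ (baire_space R x0))|].
by apply: subsetC => x Ex; exists (code h) => //; exists k.
Qed.
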